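(* Let $X\subset\mathbb R^m$ be compact with finite intrinsic distance $d_X$ on $X\times X$, let $S_n\subseteq X$ be a finite subset, let $f\colon X\to\mathbb R$ be continuous with $(X,f)$ a constructible $\mathbb R$-space, let $\omega_f$ be a fixed non-decreasing modulus of continuity of $f$ with respect to $d_X$, and let $R=\mathfrak R(X,f)$. Let $\delta>0$ be an intrinsic covering radius for $S_n$: for all $x\in X$ there is $s\in S_n$ with $d_X(x,s)\le\delta$. Then $$d_I\bigl(\mathcal F_R,\mathcal R_\delta^{S_n,d_X}\bigr)\le\mu_\delta .$$ If $\omega_f$ is concave and $\omega_f(0)=0$, then $d_I(\mathcal F_R,\mathcal R_\delta^{S_n,d_X})\le\omega_f(\delta)$. In particular, if $f$ is $1$-Lipschitz with respect to $d_X$, then $d_I(\mathcal F_R,\mathcal R_\delta^{S_n,d_X})\le\delta$.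
   Context: **Intrinsic distance.** $d_X(x,y)$ is the infimum of the lengths (suprema of Euclidean polygonal sums) of continuous paths in $X$ from $x$ to $y$ ($+\infty$ if there is no path). When $d_X(x,y)<\infty$, a minimizing geodesic exists. **Constructible $\mathbb R$-spaces.** $(X,f)$, $f\colon X\to\mathbb R$ continuous, is constructible if it is isomorphic over $\mathbb R$ to a space built from finitely many reals $a_0<\dots<a_n$, compact locally path-connected spaces $V_0,\dots,V_n$, $E_0,\dots,E_{n-1}$ and continuous maps $l_i\colon E_i\to V_i$, $r_i\colon E_i\to V_{i+1}$ as the quotient of $\bigsqcup_i V_i\times\{a_i\}\sqcup\bigsqcup_iE_i\times[a_i,a_{i+1}]$ by $(x,a_i)\sim(l_i(x),a_i)$, $(x,a_{i+1})\sim(r_i(x),a_{i+1})$, with $f$ the second projection. The Reeb graph $\mathfrak R(X,f)=(X/\!\sim_f,\bar f)$ identifies points lying in the same path component of a level set of $f$. **Cosheaves and interleaving distance.** $\mathbf{Int}$ is the poset category of open intervals of $\mathbb R$. For an $\mathbb R$-space $(Y,g)$, $\mathcal F_{(Y,g)}(I)=\pi_0(g^{-1}(I))$, with maps induced by inclusion; $\mathcal F_R$ is this functor for the Reeb graph $R$, and it is canonically isomorphic to $\mathcal F_{(X,f)}$. For $I=(a,b)$ put $I^\varepsilon=(a-\varepsilon,b+\varepsilon)$ and $\mathcal S_\varepsilon(\mathcal G)(I)=\mathcal G(I^\varepsilon)$. An $\varepsilon$-interleaving of $\mathcal F,\mathcal G$ is a pair of natural transformations $\varphi\colon\mathcal F\Rightarrow\mathcal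 S_\varepsilon\mathcal G$, $\psi\colon\mathcal G\Rightarrow\mathcal S_\varepsilon\mathcal F$ such that $\mathcal S_\varepsilon(\psi)\circ\varphi$ and $\mathcal S_\varepsilon(\varphi)\circ\psi$ are the canonical transformations induced by $I\subseteq I^{2\varepsilon}$. $d_I(\mathcal F,\mathcal G)$ is the infimum of such $\varepsilon\ge0$. **Modulus and scale.** $\omega_f\colon[0,\infty)\to[0,\infty)$ is non-decreasing with $\omega_f(0)=0$ and $|f(x)-f(y)|\le\omega_f(d_X(x,y))$ for all $x,y\in X$. For each pair $x,y$ fix a minimizing $d_X$-geodesic $\gamma_{xy}\colon[0,1]\to X$ from $x$ to $y$, parametrized proportionally to arc length. For $\delta>0$, $$\theta_f(\delta)=\sup_{x,y\in X,\ d_X(x,y)\le2\delta}\max\Bigl\{\tfrac12|f(x)-f(y)|,\ \sup_{t\in[0,1]}\bigl|f(\gamma_{xy}(t))-((1-t)f(x)+tf(y))\bigr|\Bigr\},\qquad \mu_\delta=\max\{\omega_f(\delta),\theta_f(\delta)\}.$$ **PL-Reeb estimator.** $\Gamma_\delta^{S_n,d_X}$ is the graph with vertex set $S_n$ in which distinct $x,y$ are joined by an edge iff $d_X(x,y)\le2\delta$. $\hat f_n^{d_X}\colon|\Gamma_\delta^{S_n,d_X}|\to\mathbb R$ is the extension of $f|_{S_n}$ to the geometric realization that is affine on each edge. $\mathcal R_\delta^{S_n,d_X}$ is the functor $I\mapsto\pi_0\bigl((\hat f_n^{d_X})^{-1}(I)\bigr)$. *)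

(* Defs.v *)
From HB Require Import structures.
From Stdlib Require Import Relation_Operators.
From mathcomp Require Import all_boot all_order all_algebra finmap generic_quotient.
From mathcomp Require Import all_classical all_reals all_analysis.
From mathcomp Require Import ring lra.

Set Implicit Arguments.
Unset Strict Implicit.
Unset Printing Implicit Defensive.

Import Order.TTheory GRing.Theory Num.Theory.
Import numFieldNormedType.Exports.

Local Open Scope classical_set_scope.
Local Open Scope ring_scope.
Local Open Scope quotient_scope.

(* A path is a function on the whole line of which only the restriction to
   [0, 1] matters. *)
Definition is_path (R : realType) (Y : topologicalType) (A : set Y) (x y : Y)
    (p : R -> Y) : Prop :=
  [/\ {within `[0, 1], continuous p}, p 0 = x, p 1 = y &
      forall t : R, t \in `[0, 1] -> A (p t)].

Definition path_joined (R : realType) (Y : topologicalType) (A : set Y)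
    (x y : Y) : Prop :=
  exists p : R -> Y, is_path A x y p.

Section path_joined_equivalence.
Context (R : realType) (Y : topologicalType).
Implicit Types (A B : set Y) (x y z : Y).

Lemma within_comp (p : R -> Y) (g : R -> R) (D E : set R) :
  continuous g -> (forall t, D t -> E (g t)) ->
  {within E, continuous p} -> {within D, continuous (p \o g)}.
Proof.
move=> cg gDE cp; apply/subspace_continuousP => t Dt U pU.
move/subspace_continuousP: cp => /(_ (g t) (gDE t Dt) U pU) nU.
have := cg t _ nU; rewrite /within /nbhs /= => H.
by near=> s => Ds; apply: (near H s) => //; exact: gDE.
Unshelve. all: by end_near. Qed.

Lemma path_joined_refl A x : A x -> path_joined R A x x.
Proof.
by move=> Ax; exists (cst x); split => //; apply: continuous_subspaceT => t;
  exact: cvg_cst.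
Qed.

Lemma path_joined_sym A x y : path_joined R A x y -> path_joined R A y x.
Proof.
move=> [p [cp p0 p1 pA]]; exists (p \o (fun t => 1 - t)); split => /=.
- apply: within_comp cp.
    by move=> t; apply: cvgB; [exact: cvg_cst | exact: cvg_id].
  by move=> t /=; rewrite !in_itv /= => /andP[t0 t1]; lra.
- by rewrite subr0.
- by rewrite subrr.
- by move=> t; rewrite in_itv /= => /andP[t0 t1]; apply: pA; rewrite in_itv /=; lra.
Qed.

Lemma path_joined_trans A x y z :
  path_joined R A x y -> path_joined R A y z -> path_joined R A x z.
Proof.
move=> [p [cp p0 p1 pA]] [q [cq q0 q1 qA]].
pose g t : Y := if t <= 2^-1 then p (2 * t) else q (2 * t - 1).
exists g; split.
- rewrite (_ : [set` `[0, 1]] = `[0, 2^-1] `|` `[2^-1, (1 : R)]); last first.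
    apply/seteqP; split => t /=; rewrite !in_itv /=.
      by case: (leP t 2^-1) => ? /andP[? ?]; [left | right]; lra.
    by case=> /andP[? ?]; lra.
  apply: withinU_continuous; [exact: itv_closed.. | |].
  + apply: (@subspace_eq_continuous _ _ _ (from_subspace _ (p \o (fun t => 2 * t)))).
      by move=> t; rewrite inE /= in_itv /= /from_subspace /g => /andP[_ ->].
    apply: within_comp cp.
      by move=> t; apply: cvgM; [exact: cvg_cst | exact: cvg_id].
    by move=> t /=; rewrite !in_itv /= => /andP[t0 t1]; lra.
  + apply: (@subspace_eq_continuous _ _ _ (from_subspace _ (q \o (fun t => 2 * t - 1)))).
      move=> t; rewrite inE /= in_itv /= /from_subspace /g => /andP[t0 _].
      case: (leP t 2^-1) => // t1.
      have t2 : 2 * t = 1 by lra.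
      by rewrite /= t2 subrr q0 p1.
    apply: within_comp cq.
      move=> t; apply: cvgB; last exact: cvg_cst.
      by apply: cvgM; [exact: cvg_cst | exact: cvg_id].
    by move=> t /=; rewrite !in_itv /= => /andP[t0 t1]; lra.
- by rewrite /g invr_ge0 ler0n mulr0.
- have h : ((1 : R) <= 2^-1) = false by apply/negbTE; rewrite -ltNge invf_lt1 ?ltr1n.
  have e : 2 * 1 - 1 = 1 :> R by ring.
  by rewrite /g h e q1.
- move=> t; rewrite in_itv /= /g => /andP[t0 t1]; case: (leP t 2^-1) => h.
    by apply: pA; rewrite in_itv /=; lra.
  by apply: qA; rewrite in_itv /=; lra.
Qed.

Lemma path_joined_subset A B x y :
  A `<=` B -> path_joined R A x y -> path_joined R B x y.
Proof. by move=> AB [p [cp p0 p1 pA]]; exists p; split => // t /pA /AB. Qed.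

End path_joined_equivalence.

Definition path_connected (R : realType) (Y : topologicalType) (A : set Y) :=
  A !=set0 /\ forall x y, A x -> A y -> path_joined R A x y.

Definition locally_path_connected (R : realType) (Y : topologicalType) :=
  forall (x : Y) (U : set Y), nbhs x U ->
    exists V, [/\ open V, V x, V `<=` U & path_connected R V].

Section pi0.
Context (R : realType) (Y : topologicalType).
Implicit Types A B C : set Y.

Definition joined_in A : rel A := fun x y => `[< path_joined R A (\val x) (\val y) >].

Lemma joined_in_refl A : reflexive (@joined_in A).
Proof. by move=> x; apply/asboolP/path_joined_refl; exact: set_valP. Qed.

Lemma joined_in_sym A : symmetric (@joined_in A).
Proof. by move=> x y; apply/asboolP/asboolP; exact: path_joined_sym. Qed.

Lemma joined_in_trans A : transitive (@joined_in A).
Proof.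
move=> y x z /asboolP xy /asboolP yz; apply/asboolP.
exact: path_joined_trans xy yz.
Qed.

Definition joined_in_equiv A : equiv_rel A :=
  EquivRel (@joined_in A) (@joined_in_refl A) (@joined_in_sym A)
    (@joined_in_trans A).

Definition pi0 A : Type := {eq_quot (joined_in_equiv A)}.

Definition component A (x : A) : pi0 A := \pi_({eq_quot (joined_in_equiv A)}) x.

Lemma component_eqP A (x y : A) :
  component x = component y <-> path_joined R A (\val x) (\val y).
Proof. by split=> [/eqmodP/asboolP | xy]; last exact/eqmodP/asboolP. Qed.

Definition inclusion A B (AB : A `<=` B) (x : A) : B :=
  exist _ (\val x) (mem_set (AB _ (set_valP x))).

Definition pi0_incl A B (AB : A `<=` B) (c : pi0 A) : pi0 B :=
  component (inclusion AB (repr (c : {eq_quot (joined_in_equiv A)}))).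

Lemma pi0_inclE A B (AB : A `<=` B) (x : A) :
  pi0_incl AB (component x) = component (inclusion AB x).
Proof.
apply/component_eqP => /=; apply: (path_joined_subset AB).
by apply/component_eqP; exact: reprK.
Qed.

Lemma component_repr A (c : pi0 A) :
  component (repr (c : {eq_quot (joined_in_equiv A)})) = c.
Proof. exact: reprK. Qed.

Lemma pi0_incl_id A (AA : A `<=` A) (c : pi0 A) : pi0_incl AA c = c.
Proof.
by rewrite -[RHS]component_repr; congr component; exact: val_inj.
Qed.

Lemma pi0_incl_comp A B C (AB : A `<=` B) (BC : B `<=` C) (AC : A `<=` C)
    (c : pi0 A) : pi0_incl BC (pi0_incl AB c) = pi0_incl AC c.
Proof.
by rewrite -[c]component_repr !pi0_inclE; congr component; exact: val_inj.
Qed.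

End pi0.

(* Open intervals are nonempty and may be unbounded. *)
Record open_interval (R : realType) := OpenInterval {
  lo : \bar R;
  hi : \bar R;
  lo_lt_hi : (lo < hi)%E
}.

Definition interval_set (R : realType) (I : open_interval R) : set R :=
  [set x | (lo I < x%:E < hi I)%E].
Coercion interval_set : open_interval >-> set.

Lemma thicken_subproof (R : realType) (e : {nonneg R}) (I : open_interval R) :
  (lo I - e%:num%:E < hi I + e%:num%:E)%E.
Proof.
case: I => -[a| |] [b| |] //=; rewrite ?ltNyr ?ltry // !lte_fin => ab.
have e0 : 0 <= e%:num by [].
by apply: (@le_lt_trans _ _ a); [lra | apply: (lt_le_trans ab); lra].
Qed.

Definition thicken (R : realType) (e : {nonneg R}) (I : open_interval R) :
    open_interval R :=
  OpenInterval (thicken_subproof e I).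

Lemma lte_dense (R : realType) (a b : \bar R) :
  (a < b)%E -> exists x : R, (a < x%:E < b)%E.
Proof.
case: a b => [a| |] [b| |] //=; rewrite ?ltNyr ?ltry // ?lte_fin => ab.
- by exists ((a + b) / 2); rewrite !lte_fin; lra.
- by exists (a + 1); rewrite lte_fin ltry; lra.
- by exists (b - 1); rewrite lte_fin ltNyr; lra.
- by exists 0; rewrite ltNyr ltry.
Qed.

Lemma interval_subP (R : realType) (I J : open_interval R) :
  I `<=` J <-> (lo J <= lo I)%E /\ (hi I <= hi J)%E.
Proof.
have IE := lo_lt_hi I; split=> [IJ | [ll hh] x /andP[Ix xI]]; last first.
  by apply/andP; split; [exact: le_lt_trans Ix | exact: lt_le_trans xI _].
split; rewrite leNgt; apply/negP => h.
- have /lte_dense[x /andP[x1]] : (lo I < Order.min (lo J) (hi I))%E.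
    by rewrite lt_min h.
  rewrite lt_min => /andP[x2 x3].
  have /IJ/andP[x4 _] : interval_set I x by apply/andP.
  by have := lt_trans x2 x4; rewrite ltxx.
- have /lte_dense[x /andP[x1 x2]] : (Order.max (hi J) (lo I) < hi I)%E.
    by rewrite gt_max h.
  move: x1; rewrite gt_max => /andP[x1 x3].
  have /IJ/andP[_ x4] : interval_set I x by apply/andP.
  by have := lt_trans x4 x1; rewrite ltxx.
Qed.

Lemma thicken_subset (R : realType) (e : {nonneg R}) (I J : open_interval R) :
  I `<=` J -> thicken e I `<=` thicken e J.
Proof.
move/interval_subP => [ll hh]; apply/interval_subP.
by split; [exact: leeB ll (lexx _) | exact: leeD hh (lexx _)].
Qed.

Arguments thicken_subset {R} e {I J}.

Lemma sub_thicken (R : realType) (e : {nonneg R}) (I : open_interval R) :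
  I `<=` thicken e I.
Proof.
have e0 : (0 <= e%:num%:E :> \bar R)%E by rewrite lee_fin.
by apply/interval_subP; split; [apply: geeDl; rewrite leeNl oppe0 | exact: leeDl].
Qed.

Lemma sub_thicken2 (R : realType) (e : {nonneg R}) (I : open_interval R) :
  I `<=` thicken e (thicken e I).
Proof. by move=> x Ix; do 2 apply: sub_thicken. Qed.

Arguments sub_thicken2 {R} e I.

Lemma thicken_thicken (R : realType) (e : {nonneg R}) (I : open_interval R) :
  thicken e (thicken e I) = thicken (e%:num *+ 2)%:nng I.
Proof.
case: I => a b ab; rewrite /thicken /=.
have E1 : (a - e%:num%:E - e%:num%:E = a - (e%:num *+ 2)%:E)%E.
  by case: a {ab} => [a| |] //=; rewrite -!EFinB; congr EFin; lra.
have E2 : (b + e%:num%:E + e%:num%:E = b + (e%:num *+ 2)%:E)%E.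
  by rewrite mulr2n EFinD addeA.
move: (thicken_subproof _ _) (thicken_subproof _ _) => /=.
rewrite E1 E2 => p q; congr OpenInterval; exact: Prop_irrelevance.
Qed.

Record int_functor (R : realType) := IntFunctor {
  int_obj :> open_interval R -> Type;
  int_map : forall I J : open_interval R, I `<=` J -> int_obj I -> int_obj J;
  int_map_id : forall (I : open_interval R) (II : I `<=` I) x, int_map II x = x;
  int_map_comp : forall (I J K : open_interval R) (IJ : I `<=` J) (JK : J `<=` K) (IK : I `<=` K) x,
    int_map JK (int_map IJ x) = int_map IK x
}.

Definition smoothing (R : realType) (e : {nonneg R}) (G : int_functor R) :
    int_functor R :=
  @IntFunctor R (fun I => G (thicken e I))
    (fun I J IJ => int_map (thicken_subset e IJ))
    (fun I II => int_map_id (thicken_subset e II))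
    (fun I J K IJ JK IK => int_map_comp (thicken_subset e IJ)
       (thicken_subset e JK) (thicken_subset e IK)).

Record nat_trans (R : realType) (F G : int_functor R) := NatTrans {
  nt_app :> forall I, F I -> G I;
  nt_natural : forall (I J : open_interval R) (IJ : I `<=` J) x,
    @nt_app J (int_map IJ x) = int_map IJ (@nt_app I x)
}.
Arguments nt_app {R F G} n I x.

(* The thickening I^(2e) appears as (I^e)^e, see [thicken_thicken]. *)
Definition interleaving (R : realType) (e : {nonneg R}) (F G : int_functor R)
    (phi : nat_trans F (smoothing e G)) (psi : nat_trans G (smoothing e F)) :=
  (forall I (x : F I),
     psi (thicken e I) (phi I x) = int_map (sub_thicken2 e I) x) /\
  (forall I (y : G I),
     phi (thicken e I) (psi I y) = int_map (sub_thicken2 e I) y).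

Definition interleaved (R : realType) (e : {nonneg R}) (F G : int_functor R) :=
  exists phi psi, @interleaving R e F G phi psi.

Definition interleaving_dist (R : realType) (F G : int_functor R) : \bar R :=
  ereal_inf [set (e%:num)%:E | e in [set e : {nonneg R} | interleaved e F G]].

Definition pi0_functor (R : realType) (Y : topologicalType) (g : Y -> R) :
    int_functor R :=
  @IntFunctor R (fun I => pi0 R (g @^-1` I))
    (fun I J IJ => pi0_incl (preimage_subset (f := g) IJ))
    (fun I II => pi0_incl_id (preimage_subset (f := g) II))
    (fun I J K IJ JK IK => pi0_incl_comp (preimage_subset (f := g) IJ)
       (preimage_subset (f := g) JK) (preimage_subset (f := g) IK)).

Section reeb.
Context (R : realType) (Y : topologicalType) (f : Y -> R).

Definition reeb_rel : rel Y :=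
  fun x y => `[< path_joined R (f @^-1` [set f x]) x y >].

Lemma reeb_rel_level x y : reeb_rel x y -> f x = f y.
Proof.
move/asboolP => [p [_ _ <- /(_ 1)]]; rewrite in_itv /= ler01 lexx /=.
by move=> ->.
Qed.

Lemma reeb_rel_refl : reflexive reeb_rel.
Proof. by move=> x; apply/asboolP/path_joined_refl. Qed.

Lemma reeb_rel_sym : symmetric reeb_rel.
Proof.
suff H x y : reeb_rel x y -> reeb_rel y x by move=> x y; apply/idP/idP; exact: H.
move=> xy; apply/asboolP; rewrite -(reeb_rel_level xy).
by apply: path_joined_sym; apply/asboolP.
Qed.

Lemma reeb_rel_trans : transitive reeb_rel.
Proof.
move=> y x z xy /asboolP yz; apply/asboolP.
move: yz; rewrite -(reeb_rel_level xy); apply: path_joined_trans.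
exact/asboolP.
Qed.

Definition reeb_equiv : equiv_rel Y :=
  EquivRel reeb_rel reeb_rel_refl reeb_rel_sym reeb_rel_trans.

Definition reeb_space : topologicalType :=
  quotient_topology {eq_quot reeb_equiv}.

Definition reeb_pi : Y -> reeb_space := \pi_(quotient_topology {eq_quot reeb_equiv}).

Definition reeb_fun (z : reeb_space) : R :=
  f (repr (z : quotient_topology {eq_quot reeb_equiv})).

Lemma reeb_funE (x : Y) : reeb_fun (reeb_pi x) = f x.
Proof.
apply: reeb_rel_level.
have /eqmodP // : repr (\pi_({eq_quot reeb_equiv}) x) = x %[mod {eq_quot reeb_equiv}].
exact: reprK.
Qed.

End reeb.

Section generated_equivalence.
Context (T : choiceType) (r : T -> T -> Prop).

Definition gen_rel : rel T := fun x y => `[< clos_refl_sym_trans T r x y >].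

Lemma gen_rel_refl : reflexive gen_rel.
Proof. by move=> x; apply/asboolP/rst_refl. Qed.

Lemma gen_rel_sym : symmetric gen_rel.
Proof. by move=> x y; apply/asboolP/asboolP; exact: rst_sym. Qed.

Lemma gen_rel_trans : transitive gen_rel.
Proof. by move=> y x z /asboolP xy /asboolP yz; apply/asboolP/(rst_trans _ _ _ y). Qed.

Definition gen_equiv : equiv_rel T :=
  EquivRel gen_rel gen_rel_refl gen_rel_sym gen_rel_trans.

End generated_equivalence.

Definition left_end n (i : 'I_n) : 'I_n.+1 := widen_ord (leqnSn n) i.
Definition right_end n (i : 'I_n) : 'I_n.+1 := lift ord0 i.

Record tower_data (R : realType) := TowerData {
  td_n : nat;
  td_a : 'I_td_n.+1 -> R;
  td_V : 'I_td_n.+1 -> topologicalType;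
  td_E : 'I_td_n -> topologicalType;
  td_l : forall i, td_E i -> td_V (left_end i);
  td_r : forall i, td_E i -> td_V (right_end i);
  td_a_increasing : forall i j : 'I_td_n.+1, (i < j)%N -> td_a i < td_a j;
  td_V_compact : forall i, compact [set: td_V i];
  td_V_lpc : forall i, locally_path_connected R (td_V i);
  td_E_compact : forall i, compact [set: td_E i];
  td_E_lpc : forall i, locally_path_connected R (td_E i);
  td_l_continuous : forall i, continuous (@td_l i);
  td_r_continuous : forall i, continuous (@td_r i)
}.

Section tower.
Context (R : realType) (D : tower_data R).
Local Notation n := (td_n D).

Definition td_band (i : 'I_n) : set R :=
  [set` `[td_a (left_end i), td_a (right_end i)]].

Definition td_piece (k : 'I_n.+1 + 'I_n) : topologicalType :=
  match k with
  | inl i => (td_V i * [set td_a i])%type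
  | inr i => (td_E i * td_band i)%type
  end.

Definition td_sum : topologicalType := {k & td_piece k}.

Definition vertex_pt (i : 'I_n.+1) (v : td_V i) (s : [set td_a i]) : td_sum :=
  existT td_piece (inl i) (v, s).

Definition edge_pt (i : 'I_n) (x : td_E i) (s : td_band i) : td_sum :=
  existT td_piece (inr i) (x, s).

Inductive td_glue : td_sum -> td_sum -> Prop :=
| td_glue_left i (x : td_E i) (s : td_band i) (s' : [set td_a (left_end i)]) :
    \val s = td_a (left_end i) -> td_glue (edge_pt x s) (vertex_pt (td_l x) s')
| td_glue_right i (x : td_E i) (s : td_band i) (s' : [set td_a (right_end i)]) :
    \val s = td_a (right_end i) -> td_glue (edge_pt x s) (vertex_pt (td_r x) s').

Definition td_height (z : td_sum) : R :=
  match z with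
  | existT (inl i) q => \val q.2
  | existT (inr i) q => \val q.2
  end.

Lemma td_height_glue z z' : clos_refl_sym_trans td_sum td_glue z z' ->
  td_height z = td_height z'.
Proof.
elim=> {z z'} [z z' | // | z z' _ -> // | z z' z'' _ -> _ -> //].
by case=> i x s s' /= ->; have := set_valP s' => /= ->.
Qed.

Definition tower_space : topologicalType :=
  quotient_topology {eq_quot (gen_equiv td_glue)}.

Definition tower_pi : td_sum -> tower_space :=
  \pi_(quotient_topology {eq_quot (gen_equiv td_glue)}).

Definition tower_fun (z : tower_space) : R :=
  td_height (repr (z : quotient_topology {eq_quot (gen_equiv td_glue)})).

Lemma tower_funE (z : td_sum) : tower_fun (tower_pi z) = td_height z.
Proof.
apply: td_height_glue; apply/asboolP.
pose Q := {eq_quot (gen_equiv td_glue)}.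
have /eqmodP // : repr (\pi_Q z) = z %[mod Q].
exact: reprK.
Qed.

End tower.

Definition isomorphic_over (R : realType) (Y Z : topologicalType)
    (g : Y -> R) (h : Z -> R) : Prop :=
  exists (u : Y -> Z) (v : Z -> Y),
    [/\ continuous u, continuous v, cancel u v, cancel v u & h \o u = g].

Definition constructible (R : realType) (Y : topologicalType) (g : Y -> R) :=
  exists D : tower_data R, isomorphic_over g (@tower_fun R D).

Definition euclid_norm (R : realType) (m : nat) (v : 'rV[R]_m) : R :=
  Num.sqrt (\sum_i v ord0 i ^+ 2).

Definition polygonal_sum (R : realType) (m : nat) (p : R -> 'rV[R]_m) (a : R)
    (s : seq R) : R :=
  \sum_(0 <= i < size s)
     euclid_norm (p (nth a (a :: s) i.+1) - p (nth a (a :: s) i)).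

(* Length of the restriction of p to [a, b] *)
Definition curve_length (R : realType) (m : nat) (a b : R) (p : R -> 'rV[R]_m) :
    \bar R :=
  ereal_sup [set (polygonal_sum p a s)%:E | s in itv_partition a b].

Section intrinsic.
Context (R : realType) (m : nat) (X : set 'rV[R]_m).

Definition intrinsic_dist (x y : X) : \bar R :=
  ereal_inf [set curve_length 0 1 (set_val \o p) |
               p in [set p : R -> X | is_path [set: X] x y p]].

Definition minimizing_geodesic (x y : X) (g : R -> X) : Prop :=
  [/\ is_path [set: X] x y g,
      curve_length 0 1 (set_val \o g) = intrinsic_dist x y &
      forall t : R, t \in `[0, 1] ->
        curve_length 0 t (set_val \o g) =
        (t%:E * curve_length 0 1 (set_val \o g))%E].

(* The modulus is a function [0, +oo[ -> [0, +oo[; its values at negative reals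
   are irrelevant. *)
Definition modulus_of_continuity (f : X -> R) (omega : R -> R) : Prop :=
  [/\ forall u, 0 <= u -> 0 <= omega u,
      forall u v, 0 <= u -> u <= v -> omega u <= omega v,
      omega 0 = 0 &
      forall x y : X, `|f x - f y| <= omega (fine (intrinsic_dist x y))].

Definition theta (f : X -> R) (gamma : X -> X -> R -> X) (delta : R) : \bar R :=
  ereal_sup
    [set maxe (2^-1 * `|f z.1 - f z.2|)%:E
           (ereal_sup
              [set `|f (gamma z.1 z.2 t) - ((1 - t) * f z.1 + t * f z.2)|%:E |
                 t in [set` `[(0 : R), 1]]])
       | z in [set z : X * X | (intrinsic_dist z.1 z.2 <= (2 * delta)%:E)%E]].

Definition mu (f : X -> R) (omega : R -> R) (gamma : X -> X -> R -> X)
    (delta : R) : \bar R :=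
  maxe (omega delta)%:E (theta f gamma delta).

Definition covering_radius (S : {fset X}) (delta : R) : Prop :=
  forall x : X, exists2 s : X, s \in S & (intrinsic_dist x s <= delta%:E)%E.

Definition lipschitz1 (f : X -> R) : Prop :=
  forall x y : X, (`|f x - f y|%:E <= intrinsic_dist x y)%E.

End intrinsic.

Definition concave_nonneg (R : realType) (omega : R -> R) : Prop :=
  forall u v t : R, 0 <= u -> 0 <= v -> 0 <= t <= 1 ->
    (1 - t) * omega u + t * omega v <= omega ((1 - t) * u + t * v).

(* Barycentric coordinates: a point of the realization is a probability vector
   on the vertices whose support is contained in a vertex or in an edge. *)
Definition realization (R : realType) (W : finType) (adj : W -> W -> Prop) :
    set {ptws W -> R} :=
  [set p | [/\ forall v, 0 <= p v, \sum_v p v = 1 &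
      exists x y, (x = y \/ adj x y) /\
        forall v, p v != 0 -> v = x \/ v = y]].

Arguments realization R {W} adj.

Definition affine_extension (R : realType) (W : finType) (adj : W -> W -> Prop)
    (h : W -> R) (p : realization R adj) : R :=
  \sum_v \val p v * h v.

Section estimator.
Context (R : realType) (m : nat) (X : set 'rV[R]_m).

Definition sample_adj (S : {fset X}) (delta : R) (x y : S) : Prop :=
  x != y /\ (intrinsic_dist (\val x) (\val y) <= (2 * delta)%:E)%E.

Definition sample_complex (S : {fset X}) (delta : R) : topologicalType :=
  realization R (@sample_adj S delta).

Definition pl_fun (S : {fset X}) (f : X -> R) (delta : R) :
    sample_complex S delta -> R :=
  @affine_extension R S (@sample_adj S delta) (fun v => f (\val v)).

Definition pl_reeb_estimator (S : {fset X}) (f : X -> R) (delta : R) :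
    int_functor R :=
  pi0_functor (@pl_fun S f delta).

End estimator.

(* Main.v *)
Require Import Defs.
From mathcomp Require Import all_boot all_order all_algebra finmap generic_quotient.
From mathcomp Require Import all_classical all_reals all_analysis.
From mathcomp Require Import ring lra.

Set Implicit Arguments.
Unset Strict Implicit.
Unset Printing Implicit Defensive.

Import Order.TTheory GRing.Theory Num.Theory.
Import numFieldNormedType.Exports.

Local Open Scope classical_set_scope.
Local Open Scope ring_scope.
Local Open Scope quotient_scope.

(* Write [fhat] for the piecewise-affine extension of [f] to the realization.
   Mapping each edge to its chosen geodesic gives a continuous map [G] from the
   realization to [X] with [|f (G p) - fhat p| <= theta]; mapping a point of [X]
   to a nearest sample gives the other half of the interleaving, at cost
   [omega delta]. The latter is not continuous, but closed intrinsic balls are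
   closed in [X] by compactness of the set of Lipschitz curves, so a path in [X]
   is covered by finitely many closed balls whose centres are adjacent whenever
   the balls meet; connectedness of the path then joins the nearest samples of
   its endpoints. The Reeb space enters only through the fact that [X] is locally
   path-connected, being a quotient of a locally path-connected space: path
   components of preimages of open intervals are open and saturated, so they are
   not merged in the Reeb space. *)

(** * Path components in the Reeb space *)

Section paths.
Context (R : realType).

Lemma path_joined_mem (Y : topologicalType) (A : set Y) (x y : Y) :
  path_joined R A x y -> A x /\ A y.
Proof.
move=> [p [_ <- <- pA]].
by split; apply: pA; rewrite in_itv /= ?lexx ?ler01.
Qed.

Lemma path_joined_image (Y Z : topologicalType) (g : Y -> Z) (A : set Y)
    (B : set Z) (x y : Y) :
  continuous g -> (forall a, A a -> B (g a)) ->
  path_joined R A x y -> path_joined R B (g x) (g y).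
Proof.
move=> cg gAB [p [cp p0 p1 pA]]; exists (g \o p); split => /=; rewrite ?p0 ?p1 //.
  by move=> t; apply: (@continuous_comp (subspace _) Y Z p g t (cp t)); exact: cg.
by move=> t /pA /gAB.
Qed.

(** The image of the path is connected, and [C] cuts out of it a nonempty part that is relatively
    both closed and open. *)
Lemma path_joined_closed (Y : topologicalType) (A C D : set Y) (x y : Y) :
  closed C -> closed D -> A `<=` C `|` D -> (forall a, A a -> C a -> ~ D a) ->
  path_joined R A x y -> C x -> C y.
Proof.
move=> clC clD cover disj [p [cp p0 p1 pA]] Cx.
have I0 : (0 : R) \in `[0, 1] by rewrite in_itv /= lexx ler01.
have I1 : (1 : R) \in `[0, 1] by rewrite in_itv /= lexx ler01.
pose P := p @` [set` `[(0 : R), 1]].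
have PA : P `<=` A by move=> _ [t tI <-]; exact: pA.
have cP : connected P.
  exact: connected_continuous_connected (@segment_connected _ _ _) cp.
have PE : P `&` C = P.
  apply: cP; first by exists x; split => //; exists 0.
  - exists (~` D); first exact: closed_openC.
    apply/seteqP; split => a [Pa Ca]; split => //.
      exact: disj (PA _ Pa) Ca.
    by case: (cover _ (PA _ Pa)).
  - by exists C.
have [] : (P `&` C) y by rewrite PE; exists 1.
by [].
Qed.

(** Inside [A] each of the two open sets is the complement of the other, so the closed version
    applies to the complements with their roles exchanged. *)
Lemma path_joined_open (Y : topologicalType) (A C D : set Y) (x y : Y) :
  open C -> open D -> A `<=` C `|` D -> (forall a, A a -> C a -> ~ D a) ->
  path_joined R A x y -> C x -> C y.
Proof.
move=> oC oD cover disj xy Cx; have [_ Ay] := path_joined_mem xy.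
have [//|Dy] := cover _ Ay.
have [Ax _] := path_joined_mem xy.
exfalso; apply: (disj x Ax Cx); apply: contrapT => nDx.
suff : (~` D) y by [].
apply: (path_joined_closed (open_closedC oD) (open_closedC oC) _ _ xy nDx).
- move=> a Aa; case: (pselect (C a)) => [Ca | nCa]; [left | right] => //.
  exact: disj Aa Ca.
- by move=> a Aa nDa nCa; case: (cover _ Aa).
Qed.

End paths.

(** * Permanence properties of local path-connectedness *)

Section local_path_joining.
Context (R : realType).

(* The im-kleinen form of local path-connectedness, which passes to quotients. *)
Definition locally_path_joined (Y : topologicalType) :=
  forall (y : Y) (U : set Y), nbhs y U -> nbhs y (path_joined R U y).

Lemma lpc_locally_path_joined (Y : topologicalType) :
  locally_path_connected R Y -> locally_path_joined Y.
Proof.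
move=> lpc y U /lpc[V [oV Vy VU [_ Vpc]]].
apply: (@filterS _ _ _ V); last exact: open_nbhs_nbhs.
by move=> z Vz; apply: path_joined_subset VU _; exact: Vpc.
Qed.

Lemma locally_path_joined_prod (Y Z : topologicalType) :
  locally_path_joined Y -> locally_path_joined Z ->
  locally_path_joined (Y * Z)%type.
Proof.
move=> lY lZ [y z] U [[A B] /= [/lY nA /lZ nB] ABU].
exists (path_joined R A y, path_joined R B z) => //= -[y' z'] /=.
move=> [[p [cp p0 p1 pA]] [q [cq q0 q1 qB]]].
exists (fun t => (p t, q t)); split; rewrite ?p0 ?p1 ?q0 ?q1 //.
  by move=> t; apply: (cvg_pair (cp t) (cq t)).
by move=> t tI; apply: ABU; split => /=; [exact: pA | exact: qB].
Qed.

Lemma locally_path_joined_sigT (I : choiceType) (Y : I -> topologicalType) :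
  (forall i, locally_path_joined (Y i)) -> locally_path_joined {i & Y i}.
Proof.
move=> lY [i y] U nU; have {nU} nU : nbhs y (existT Y i @^-1` U) by [].
have : nbhs y (path_joined R (existT Y i @^-1` U) y) by exact: lY.
apply: (@filterS _ (nbhs y)) => z /=; apply: path_joined_image => //.
exact: existT_continuous.
Qed.

(** The preimage of a path component of [V] is open: points near [y] upstairs are joined to [y]
    inside the preimage of [V], and the projection carries these paths into [V]. *)
Lemma locally_path_joined_quotient (T : topologicalType) (Q : quotType T) :
  locally_path_joined T -> locally_path_joined (quotient_topology Q).
Proof.
move=> lT z U; rewrite {1}nbhsE => -[V [oV Vz] VU].
apply: (@filterS _ (nbhs z) _ (path_joined R V z)).
  by move=> w; exact: path_joined_subset.
apply: open_nbhs_nbhs; split; last exact: path_joined_refl.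
rewrite /open /= /quotient_open openE => y zy.
have [_ Vy] := path_joined_mem zy.
have /lT : nbhs y (\pi_(quotient_topology Q) @^-1` V).
  by apply: open_nbhs_nbhs; split.
apply: (@filterS _ (nbhs y)) => w yw; apply: path_joined_trans zy _.
by apply: path_joined_image yw => //; exact: pi_continuous.
Qed.

Lemma locally_path_joined_retract (Y Z : topologicalType) (u : Y -> Z)
    (v : Z -> Y) :
  continuous u -> continuous v -> cancel u v ->
  locally_path_joined Z -> locally_path_joined Y.
Proof.
move=> cu cv uK lZ y U nU.
have /lZ : nbhs (u y) (v @^-1` U) by apply: cv; rewrite uK.
move/cu; apply: (@filterS _ (nbhs y)) => w.
by rewrite -{2}(uK y) -{2}(uK w); exact: path_joined_image.
Qed.

Lemma within_continuous_set_type (T Y : topologicalType) (D : set T)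
    (A : set Y) (p : T -> A) :
  {within D, continuous (set_val \o p)} -> {within D, continuous p}.
Proof.
by move=> cp; apply: (@continuous_comp_initial _ _ _ set_val).
Qed.

Lemma locally_path_joined_convex (A : set R) :
  (forall a b t, A a -> A b -> 0 <= t <= 1 -> A ((1 - t) * a + t * b)) ->
  locally_path_joined A.
Proof.
move=> convA a U [_ [[W oW <-] Wa WU]].
have /nbhs_ballP[e e0 eW] : nbhs (\val a) W by exact: open_nbhs_nbhs.
have cval : continuous (set_val : A -> R) := @initial_continuous A R set_val.
have : nbhs a (set_val @^-1` ball (\val a) e).
  by apply: cval; exact: nbhsx_ballx.
apply: (@filterS _ (nbhs a)) => b /= ab.
have Aa : A (\val a) by exact: set_valP.
have Ab : A (\val b) by exact: set_valP.
pose q t : R := (1 - t) * \val a + t * \val b.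
have Aq t : 0 <= t <= 1 -> A (q t) by exact: convA.
(* The segment is sure to stay in [A] only for times in [0, 1]; wherever it leaves, [insubd] returns
   the default [a]. *)
pose p t : A := insubd a (q t).
have pE t : 0 <= t <= 1 -> \val (p t) = q t.
  by move=> t01; rewrite /p insubdK //; exact/mem_set/Aq.
exists p; split.
- apply: within_continuous_set_type.
  apply: (@subspace_eq_continuous _ _ _ (from_subspace _ q)).
    by move=> t; rewrite inE /= in_itv /= => t01; exact: (esym (pE t t01)).
  apply: continuous_subspaceT => t.
  apply: cvgD; (apply: cvgM; last exact: cvg_cst); last exact: cvg_id.
  by apply: cvgB; [exact: cvg_cst | exact: cvg_id].
- by apply: val_inj; rewrite pE ?lexx ?ler01 // /q subr0 mul1r mul0r addr0.
- by apply: val_inj; rewrite pE ?lexx ?ler01 // /q subrr mul1r mul0r add0r.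
- move=> t; rewrite in_itv /= => t01; apply: WU => /=; apply: eW.
  rewrite set_valE /= pE // /ball /= /q.
  have -> : \val a - ((1 - t) * \val a + t * \val b) = t * (\val a - \val b).
    by ring.
  have /andP[t0 t1] := t01.
  rewrite normrM ger0_norm //; apply: le_lt_trans ab.
  by rewrite ler_piMl.
Qed.

(** Each piece of the tower is the product of a locally path-connected space with a convex set of
    reals; sums, quotients and homeomorphisms keep the property. *)
Lemma constructible_locally_path_joined (Y : topologicalType) (g : Y -> R) :
  constructible g -> locally_path_joined Y.
Proof.
move=> [D [u [v [cu cv uK _ _]]]].
apply: (locally_path_joined_retract cu cv uK).
apply: locally_path_joined_quotient; apply: locally_path_joined_sigT => -[i|i].
- apply: locally_path_joined_prod; first exact/lpc_locally_path_joined/td_V_lpc.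
  by apply: locally_path_joined_convex => a b t /= -> -> _; ring.
- apply: locally_path_joined_prod; first exact/lpc_locally_path_joined/td_E_lpc.
  apply: locally_path_joined_convex => a b t /=.
  rewrite /td_band /= !in_itv /= => /andP[a0 a1] /andP[b0 b1] /andP[t0 t1].
  by apply/andP; split; nra.
Qed.

End local_path_joining.

(* Path components of [f @^-1` I] are open and saturated, so they remain
   disjoint and open in the Reeb space. *)
Lemma reeb_path_lift (R : realType) (Y : topologicalType) (f : Y -> R)
    (I : set R) (z z' : reeb_space f) :
  locally_path_joined R Y -> continuous f -> open I ->
  path_joined R (@reeb_fun R Y f @^-1` I) z z' ->
  path_joined R (f @^-1` I) (repr z) (repr z').
Proof.
move=> lY cf oI zz'; pose U := f @^-1` I.
have oU : open U by apply: open_comp => // y _; exact: cf.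
have [Uz _] := path_joined_mem zz'.
have reprP y : reeb_rel f (repr (reeb_pi f y)) y.
  have /eqmodP // : repr (reeb_pi f y) = y %[mod {eq_quot reeb_equiv f}].
  exact: reprK.
have openJ y : open (path_joined R U y).
  rewrite openE => w yw; have [_ Uw] := path_joined_mem yw.
  have /lY : nbhs w U by exact: open_nbhs_nbhs.
  by apply: (@filterS _ (nbhs w)) => w'; exact: path_joined_trans.
have levelU y y' : reeb_rel f y y' -> U y -> path_joined R U y y'.
  by move=> /asboolP yy' Uy; apply: path_joined_subset yy' => w /= fw; rewrite /U /= fw.
pose C := [set w : reeb_space f | path_joined R U (repr z) (repr w)].
pose D := [set w : reeb_space f | U (repr w) /\ ~ path_joined R U (repr z) (repr w)].
(* A Reeb class meeting [U] is path-joined within one level, hence within [U], so membership in [C]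
   does not depend on the representative. *)
have satC y : C (reeb_pi f y) <-> path_joined R U (repr z) y.
  have h := reprP y; have h' : reeb_rel f y (repr (reeb_pi f y)).
    by rewrite reeb_rel_sym.
  split=> zy; apply: path_joined_trans (zy) _.
    by apply: levelU => //; have [] := path_joined_mem zy.
  by apply: levelU => //; have [] := path_joined_mem zy.
apply: (@path_joined_open _ _ _ C D _ _ _ _ _ _ zz').
- rewrite /open /= /quotient_open (_ : _ @^-1` _ = path_joined R U (repr z)) //.
  by apply/seteqP; split => y /satC.
- rewrite /open /= /quotient_open openE => y [Uy nzy].
  have {}Uy : U y.
    by have [] := path_joined_mem (levelU _ _ (reprP y) Uy).
  have {}nzy : ~ path_joined R U (repr z) y by move/satC.
  have yy : path_joined R U y y by exact: path_joined_refl.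
  (* The whole component of [y] in [U] maps into [D]: reaching [C] from [y] would join [y] to
     [repr z]. *)
  apply: (@filterS _ (nbhs y) _ (path_joined R U y)); last exact: open_nbhs_nbhs.
  move=> w yw; have [_ Uw] := path_joined_mem yw.
  split; first by rewrite /U /= (reeb_rel_level (reprP w)).
  move/satC => zw; apply: nzy; apply: path_joined_trans zw _.
  exact: path_joined_sym.
- by move=> w Uw; case: (pselect (C w)) => Cw; [left | right].
- by move=> w _ Cw [].
- exact: path_joined_refl.
Qed.

(** * Interleavings from maps of spaces *)

Section intervals.
Context (R : realType).
Implicit Types (I : open_interval R) (e : {nonneg R}).

Lemma open_interval_open I : open (I : set R).
Proof.
rewrite (_ : (I : set R) = [set x | (lo I < x%:E)%E] `&` [set x | (x%:E < hi I)%E]).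
  exact: openI (@open_ereal_gt _ _) (@open_ereal_lt _ _).
by apply/seteqP; split => x /=; [move/andP | move=> [? ?]; apply/andP].
Qed.

Lemma thicken_near I e (x y : R) :
  (I : set R) x -> `|x - y| <= e%:num -> (thicken e I : set R) y.
Proof.
move=> /andP[Ix xI]; rewrite ler_distl => /andP[yx xy]; apply/andP; split => /=.
- rewrite EFinN lteBlDr //; apply: lt_le_trans Ix _.
  by rewrite -EFinD lee_fin; lra.
- apply: (@le_lt_trans _ _ (x%:E + e%:num%:E)%E).
    by rewrite -EFinD lee_fin; lra.
  by rewrite lteD2rE.
Qed.

Lemma interval_convex I (x y t : R) :
  (I : set R) x -> (I : set R) y -> 0 <= t <= 1 ->
  (I : set R) ((1 - t) * x + t * y).
Proof.
move=> /andP[Ix xI] /andP[Iy yI] /andP[t0 t1]; apply/andP; split.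
- case: (leP x y) => xy.
    by apply: lt_le_trans Ix _; rewrite lee_fin; nra.
  by apply: lt_le_trans Iy _; rewrite lee_fin; nra.
- case: (leP x y) => xy.
    by apply: le_lt_trans yI; rewrite lee_fin; nra.
  by apply: le_lt_trans xI; rewrite lee_fin; nra.
Qed.

End intervals.

(** * Maps that shift values by at most [e], acting on components *)

Section interleavings.
Context (R : realType) (Y Z : topologicalType) (g : Y -> R) (h : Z -> R).
Context (e : {nonneg R}) (u : Y -> Z).
Hypothesis near_u : forall y, `|g y - h (u y)| <= e%:num.
Hypothesis joined_u : forall (I : open_interval R) y y',
  path_joined R (g @^-1` I) y y' ->
  path_joined R (h @^-1` thicken e I) (u y) (u y').

Definition shift_pt (I : open_interval R) (y : g @^-1` I) :
    h @^-1` (thicken e I) :=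
  exist _ (u (\val y)) (mem_set (thicken_near (set_valP y) (near_u (\val y)))).

Definition shift_app (I : open_interval R) (c : pi0 R (g @^-1` I)) :
    pi0 R (h @^-1` (thicken e I)) :=
  component R (shift_pt (repr (c : {eq_quot (joined_in_equiv R (g @^-1` I))}))).

Lemma shift_appE (I : open_interval R) (y : g @^-1` I) :
  shift_app (component R y) = component R (shift_pt y).
Proof.
apply/component_eqP; apply: joined_u.
by apply/component_eqP; exact: component_repr.
Qed.

Lemma shift_natural (I J : open_interval R) (IJ : I `<=` J)
    (c : pi0_functor g I) :
  shift_app (int_map IJ c) =
  int_map (i := smoothing e (pi0_functor h)) IJ (shift_app c).
Proof.
rewrite -[c]component_repr /= pi0_inclE !shift_appE pi0_inclE.
by congr component; exact: val_inj.
Qed.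

Definition shift_trans : nat_trans (pi0_functor g) (smoothing e (pi0_functor h)) :=
  @NatTrans R (pi0_functor g) (smoothing e (pi0_functor h)) shift_app shift_natural.

End interleavings.

(** The path hypotheses state what components require and admit discontinuous maps, such as the
    choice of a nearby sample. The last two hypotheses are the interleaving triangles on
    representatives. *)
Lemma interleaved_of_maps (R : realType) (Y Z : topologicalType) (g : Y -> R)
    (h : Z -> R) (e : {nonneg R}) (u : Y -> Z) (v : Z -> Y) :
  (forall y, `|g y - h (u y)| <= e%:num) ->
  (forall z, `|h z - g (v z)| <= e%:num) ->
  (forall (I : open_interval R) y y', path_joined R (g @^-1` I) y y' ->
     path_joined R (h @^-1` thicken e I) (u y) (u y')) ->
  (forall (I : open_interval R) z z', path_joined R (h @^-1` I) z z' ->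
     path_joined R (g @^-1` thicken e I) (v z) (v z')) ->
  (forall (I : open_interval R) y, (I : set R) (g y) ->
     path_joined R (g @^-1` thicken e (thicken e I)) (v (u y)) y) ->
  (forall (I : open_interval R) z, (I : set R) (h z) ->
     path_joined R (h @^-1` thicken e (thicken e I)) (u (v z)) z) ->
  interleaved e (pi0_functor g) (pi0_functor h).
Proof.
move=> nu nv ju jv vu uv.
exists (shift_trans nu ju), (shift_trans nv jv); split=> I c.
- rewrite -[c]component_repr /= !shift_appE // pi0_inclE.
  by apply/component_eqP; exact/vu/(set_valP (A := g @^-1` I)).
- rewrite -[c]component_repr /= !shift_appE // pi0_inclE.
  by apply/component_eqP; exact/uv/(set_valP (A := h @^-1` I)).
Qed.

(** * The intrinsic distance *)

Section euclidean_norm.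
Context (R : realType) (m : nat).
Implicit Types u v : 'rV[R]_m.

Lemma euclid_norm_ge0 v : 0 <= euclid_norm v.
Proof. exact: sqrtr_ge0. Qed.

Lemma euclid_norm_sqr v : euclid_norm v ^+ 2 = \sum_i v ord0 i ^+ 2.
Proof. by rewrite sqr_sqrtr //; apply: sumr_ge0 => i _; exact: sqr_ge0. Qed.

Lemma euclid_normN v : euclid_norm (- v) = euclid_norm v.
Proof.
by rewrite /euclid_norm; congr Num.sqrt; apply: eq_bigr => i _; rewrite mxE sqrrN.
Qed.

Lemma euclid_norm0 : euclid_norm (0 : 'rV[R]_m) = 0.
Proof.
by rewrite /euclid_norm big1 ?sqrtr0 // => i _; rewrite mxE expr0n.
Qed.

(** The topology of row vectors comes from the sup norm; this comparison transfers Euclidean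
    estimates to it. *)
Lemma norm_le_euclid_norm v : `|v| <= euclid_norm v.
Proof.
rewrite (mx_normrE v : `|v| = _); apply: bigmax_le => [|[i j] _ /=].
  exact: euclid_norm_ge0.
rewrite (ord1 i) -sqrtr_sqr /euclid_norm ler_sqrt; last first.
  by apply: sumr_ge0 => k _; exact: sqr_ge0.
by rewrite (bigD1 j) //= lerDl; apply: sumr_ge0 => k _; exact: sqr_ge0.
Qed.

Lemma euclid_norm_continuous : continuous (@euclid_norm R m).
Proof.
have cS : continuous (fun v : 'rV[R]_m => \sum_i v ord0 i ^+ 2).
  apply: continuous_big => [|i _ v]; first exact: add_continuous.
  have c := @coord_continuous R 1 m ord0 i v.
  exact: (cvgM c c).
move=> v; exact: (continuous_comp (cS v) (@sqrt_continuous _ _)).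
Qed.

(** Cauchy-Schwarz: for positive norms a and b, the sum of the squares of b u_i - a v_i equals
    2ab(ab - u.v). *)
Lemma dot_le_euclid_norm u v :
  \sum_i u ord0 i * v ord0 i <= euclid_norm u * euclid_norm v.
Proof.
have zero (w : 'rV[R]_m) : euclid_norm w = 0 -> forall i, w ord0 i = 0.
  move=> w0 i; have /eqP := euclid_norm_sqr w; rewrite w0 expr0n /= eq_sym.
  rewrite psumr_eq0 => [/allP /(_ i)|j _]; last exact: sqr_ge0.
  by rewrite mem_index_enum sqrf_eq0 => /(_ isT) /eqP.
have := euclid_norm_ge0 u; rewrite le_eqVlt => /orP[/eqP /esym u0|u0].
  by rewrite u0 mul0r big1 // => i _; rewrite (zero u) ?mul0r.
have := euclid_norm_ge0 v; rewrite le_eqVlt => /orP[/eqP /esym v0|v0].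
  by rewrite v0 mulr0 big1 // => i _; rewrite (zero v) ?mulr0.
set a := euclid_norm u in u0 *; set b := euclid_norm v in v0 *.
have : 0 <= \sum_i (b * u ord0 i - a * v ord0 i) ^+ 2.
  by apply: sumr_ge0 => i _; exact: sqr_ge0.
rewrite (eq_bigr (fun i => b ^+ 2 * u ord0 i ^+ 2 + a ^+ 2 * v ord0 i ^+ 2 -
  2 * a * b * (u ord0 i * v ord0 i))); last by move=> i _; ring.
rewrite sumrB big_split /= -!mulr_sumr -!euclid_norm_sqr -/a -/b => h.
have ab : 0 < a * b by exact: mulr_gt0.
rewrite -subr_ge0 -(pmulr_rge0 _ ab); nra.
Qed.

Lemma euclid_normD u v : euclid_norm (u + v) <= euclid_norm u + euclid_norm v.
Proof.
have u0 := euclid_norm_ge0 u; have v0 := euclid_norm_ge0 v.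
rewrite -(@ler_pXn2r _ 2) ?nnegrE ?addr_ge0 ?euclid_norm_ge0 //.
rewrite euclid_norm_sqr (eq_bigr (fun i => u ord0 i ^+ 2 + v ord0 i ^+ 2 +
  2 * (u ord0 i * v ord0 i))); last by move=> i _; rewrite mxE; ring.
rewrite !big_split /= -mulr_sumr -!euclid_norm_sqr.
have := dot_le_euclid_norm u v; nra.
Qed.

End euclidean_norm.

(** * Polygonal sums and lengths of curves *)

Section curve_length.
Context (R : realType) (m : nat) (p : R -> 'rV[R]_m).

Lemma polygonal_sum_cons a b s :
  polygonal_sum p a (b :: s) = euclid_norm (p b - p a) + polygonal_sum p b s.
Proof.
rewrite /polygonal_sum /= big_nat_recl //=; congr +%R.
apply: eq_big_nat => i /andP[_ ilt].
rewrite (set_nth_default b) // -[RHS]/(euclid_norm (p (nth b s i) - _)).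
by rewrite [in LHS](@set_nth_default _ (b :: s) b a i) // ltnW.
Qed.

Lemma polygonal_sum_rcons a b s :
  polygonal_sum p a (rcons s b) =
  polygonal_sum p a s + euclid_norm (p b - p (last a s)).
Proof.
elim: s a => [|c s IHs] a /=; last by rewrite !polygonal_sum_cons IHs addrA.
by rewrite polygonal_sum_cons /polygonal_sum !big_geq // addr0 add0r.
Qed.

(** Each chord costs at most [c] times its time step, and the time steps telescope. *)
Lemma polygonal_sum_lipschitz c a s :
  (forall t t', a <= t -> t <= t' -> t' <= last a s ->
     euclid_norm (p t' - p t) <= c * (t' - t)) ->
  path <%R a s -> polygonal_sum p a s <= c * (last a s - a).
Proof.
elim: s a => [|b s IHs] a lip /=.
  by rewrite /polygonal_sum big_geq // subrr mulr0.
move=> /andP[ab bs]; rewrite polygonal_sum_cons.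
have bl : b <= last b s.
  have := order_path_min lt_trans bs.
  case: s {IHs lip bs} => [|d s] //= /andP[bd /allP h].
  have := mem_last d s; rewrite inE => /orP[/eqP ->|/h /ltW //]; exact: ltW.
have -> : c * (last b s - a) = c * (b - a) + c * (last b s - b) by ring.
apply: lerD; first by apply: lip => //=; exact: ltW.
apply: IHs => // t t' bt; apply: lip; apply: le_trans bt; exact: ltW.
Qed.

(** Appending [t] to a partition of [a, s] gives a partition of [a, t] with one more chord. *)
Lemma curve_length_step (a s t : R) : a <= s -> s < t ->
  (curve_length a s p + (euclid_norm (p t - p s))%:E <= curve_length a t p)%E.
Proof.
move=> as_ st; rewrite -leeBrDr //; apply: ge_ereal_sup => _ [q [qp ql] <-].
rewrite leeBrDr // -EFinD; apply: ereal_sup_ubound; exists (rcons q t).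
  split; last by rewrite last_rcons.
  by rewrite rcons_path qp (eqP ql).
by rewrite polygonal_sum_rcons (eqP ql).
Qed.

End curve_length.

(** * Lipschitz curves and closed intrinsic balls *)

Section lipschitz_curves.
Context (R : realType) (m : nat) (X : set 'rV[R]_m).
Implicit Types (x y z : X) (c : R) (g : R -> X).

(** A family of inequalities closed under pointwise limits. Given geodesics, joining by such curves
    expresses an intrinsic distance of at most [c] without infima. *)
Definition lipschitz_curve c g :=
  forall s t, 0 <= s -> s <= t -> t <= 1 ->
    euclid_norm (\val (g t) - \val (g s)) <= c * (t - s).

Definition lipschitz_joined c x y :=
  exists g, [/\ g 0 = x, g 1 = y & lipschitz_curve c g].

Lemma lipschitz_curve_norm c g s t : lipschitz_curve c g ->
  0 <= s <= 1 -> 0 <= t <= 1 ->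
  euclid_norm (\val (g t) - \val (g s)) <= c * `|t - s|.
Proof.
move=> lip /andP[s0 s1] /andP[t0 t1]; case: (leP s t) => st.
  by rewrite ger0_norm ?subr_ge0 //; exact: lip.
rewrite ltr0_norm ?subr_lt0 // opprB -euclid_normN opprB; apply: lip => //.
exact: ltW.
Qed.

Lemma lipschitz_curve_continuous c g :
  lipschitz_curve c g -> {within `[0, 1], continuous g}.
Proof.
move=> lip; apply: within_continuous_set_type.
apply/subspace_continuousP => t /=; rewrite in_itv /= => tI.
apply/cvgrPdist_lt => e e0.
(* Dividing by |c| + 1 avoids a case split on the sign of [c]. *)
have c0 : 0 < `|c| + 1 by rewrite ltr_wpDl.
have : \forall s \near t, `|t - s| < e / (`|c| + 1).
  by apply: (@cvgr_dist_lt _ _ _ (nbhs t) _ id t); [exact: cvg_id | exact: divr_gt0].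
rewrite /within /=; apply: (@filterS _ (nbhs t)) => s ts.
rewrite in_itv /= => sI; apply: le_lt_trans (norm_le_euclid_norm _) _.
apply: le_lt_trans (lipschitz_curve_norm lip sI tI) _.
rewrite ltr_pdivlMr // in ts; apply: le_lt_trans ts.
rewrite mulrC ler_wpM2l //; have := ler_norm c; lra.
Qed.

Lemma lipschitz_curve_length c g :
  lipschitz_curve c g -> (curve_length 0 1 (set_val \o g) <= c%:E)%E.
Proof.
move=> lip; apply: ge_ereal_sup => _ [s [sp /eqP sl] <-]; rewrite lee_fin.
apply: le_trans (polygonal_sum_lipschitz (c := c) _ sp) _; last first.
  by rewrite sl subr0 mulr1.
by move=> t t' t0 tt'; rewrite sl; exact: lip.
Qed.

Lemma lipschitz_joined_dist c x y :
  lipschitz_joined c x y -> (intrinsic_dist x y <= c%:E)%E.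
Proof.
move=> [g [g0 g1 lip]]; apply: ge_ereal_inf.
exists (curve_length 0 1 (set_val \o g)); last exact: lipschitz_curve_length.
by exists g => //; split => //; exact: lipschitz_curve_continuous lip.
Qed.

Lemma intrinsic_dist_ge0 x y : (0 <= intrinsic_dist x y)%E.
Proof.
apply: le_ereal_inf_tmp => _ [g _ <-].
apply: (@le_trans _ _ (polygonal_sum (set_val \o g) 0 [:: 1])%:E).
  by rewrite lee_fin; apply: sumr_ge0 => i _; exact: euclid_norm_ge0.
by apply: ereal_sup_ubound; exists [:: 1] => //; split; rewrite /= ?ltr01.
Qed.

(** By proportional parametrization the length over [0, t] exceeds that over [0, s] by [t - s] times
    the distance, and this excess dominates the chord. *)
Lemma geodesic_lipschitz c x y g : minimizing_geodesic x y g ->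
  (intrinsic_dist x y <= c%:E)%E -> lipschitz_curve c g.
Proof.
move=> [_ gE gt] dc s t s0 st t1.
have d0 := intrinsic_dist_ge0 x y.
have [r rE] : exists r, intrinsic_dist x y = r%:E.
  exists (fine (intrinsic_dist x y)); rewrite fineK // ge0_fin_numE //.
  exact: le_lt_trans dc (ltry _).
move: dc d0; rewrite rE !lee_fin => rc r0.
move: st; rewrite le_eqVlt => /orP[/eqP ->|st].
  by rewrite !subrr euclid_norm0 mulr0.
have := curve_length_step (set_val \o g) s0 st.
have sI : s \in `[0, 1] by rewrite in_itv /=; apply/andP; split => //; lra.
have tI : t \in `[0, 1] by rewrite in_itv /=; apply/andP; split => //; lra.
rewrite (gt s sI) (gt t tI) gE rE -!EFinM -EFinD lee_fin /= => h.
apply: le_trans (_ : (t - s) * r <= _); first by rewrite !set_valE in h; lra.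
by rewrite mulrC ler_wpM2r // subr_ge0 ltW.
Qed.

Lemma lipschitz_curve_rev c g :
  lipschitz_curve c g -> lipschitz_curve c (fun t => g (1 - t)).
Proof.
move=> lip s t s0 st t1; rewrite -euclid_normN opprB.
have -> : t - s = 1 - s - (1 - t) by ring.
by apply: lip; lra.
Qed.

Lemma lipschitz_joined_refl c x : 0 <= c -> lipschitz_joined c x x.
Proof.
move=> c0; exists (cst x); split => // s t s0 st t1.
by rewrite subrr euclid_norm0 mulr_ge0 // subr_ge0.
Qed.

Lemma lipschitz_joined_sym c x y :
  lipschitz_joined c x y -> lipschitz_joined c y x.
Proof.
move=> [g [g0 g1 lip]]; exists (fun t => g (1 - t)).
by split; [rewrite subr0 | rewrite subrr | exact: lipschitz_curve_rev].
Qed.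

Lemma lipschitz_joined_initial c g t : lipschitz_curve c g -> 0 <= t <= 1 ->
  lipschitz_joined (c * t) (g 0) (g t).
Proof.
move=> lip /andP[t0 t1]; exists (fun s => g (t * s)).
rewrite mulr0 mulr1; split => // s s' s0 ss' s'1.
have -> : c * t * (s' - s) = c * (t * s' - t * s) by ring.
by apply: lip; nra.
Qed.

Lemma lipschitz_joined_final c g t : lipschitz_curve c g -> 0 <= t <= 1 ->
  lipschitz_joined (c * (1 - t)) (g 1) (g t).
Proof.
move=> lip tI; have := lipschitz_joined_initial (lipschitz_curve_rev lip)
  (_ : 0 <= 1 - t <= 1).
by rewrite subr0 opprB addrCA subrr addr0; apply; lra.
Qed.

Lemma lipschitz_joined_le c c' x y : c <= c' ->
  lipschitz_joined c x y -> lipschitz_joined c' x y.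
Proof.
move=> cc' [g [g0 g1 lip]]; exists g; split => // s t s0 st t1.
by apply: le_trans (lip s t s0 st t1) _; rewrite ler_wpM2r // subr_ge0.
Qed.

(** Running both curves at double speed doubles the constant; for [c] the covering radius this is
    the edge threshold. *)
Lemma lipschitz_joined_trans c x y z :
  lipschitz_joined c x y -> lipschitz_joined c y z ->
  lipschitz_joined (2 * c) x z.
Proof.
move=> [p [p0 p1 pl]] [q [q0 q1 ql]].
pose g t : X := if t <= 2^-1 then p (2 * t) else q (2 * t - 1).
exists g; split.
- by rewrite /g invr_ge0 ler0n mulr0.
- have h : ((1 : R) <= 2^-1) = false by apply/negbTE; rewrite -ltNge invf_lt1 ?ltr1n.
  have e : 2 * 1 - 1 = 1 :> R by ring.
  by rewrite /g h e q1.
have half : (2 : R) * 2^-1 = 1 by rewrite divff.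
move=> s t s0 st t1; rewrite /g; case: (leP t 2^-1) => ht.
  rewrite (le_trans st ht).
  by have := pl (2 * s) (2 * t); lra.
case: (leP s 2^-1) => hs; last by have := ql (2 * s - 1) (2 * t - 1); lra.
(* With the junction between the two times, the chord is split there and the two bounds add up. *)
have -> : \val (q (2 * t - 1)) - \val (p (2 * s)) =
    (\val (q (2 * t - 1)) - \val (q 0)) + (\val (p 1) - \val (p (2 * s))).
  by rewrite q0 p1 addrA subrK.
apply: le_trans (euclid_normD _ _) _.
have := ql 0 (2 * t - 1); have := pl (2 * s) 1; lra.
Qed.

(* By Tychonoff, the [c]-Lipschitz curves ending at [y] form a compact set for
   pointwise convergence; the ball is its image under evaluation at [0]. *)
Lemma closed_lipschitz_ball c y :
  compact X -> closed [set x : X | lipschitz_joined c x y].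
Proof.
move=> cX.
pose T := {ptws R -> 'rV[R]_m}.
(* Curves are functions on the whole line; requiring values in [X] at every time makes [K] a product
   of copies of the compact [X]. *)
pose K : set T := [set g | forall t, X (g t)].
have cK : compact K.
  exact: (@tychonoff R (fun=> 'rV[R]_m) (fun=> X) (fun=> cX)).
have cev t : continuous (fun g : T => g t).
  exact: (@proj_continuous _ (fun _ : R => 'rV[R]_m)).
pose lip (st : R * R) : set T :=
  [set g | euclid_norm (g st.2 - g st.1) <= c * (st.2 - st.1)].
pose P : set (R * R) := [set st | [/\ 0 <= st.1, st.1 <= st.2 & st.2 <= 1]].
pose L : set T := (\bigcap_(st in P) lip st) `&` [set g | g 1 = \val y].
have clL : closed L.
  apply: closedI.
    apply: closed_bigI => -[s t] _.
    apply: (@preimage_closed T R (fun g : T => euclid_norm (g t - g s))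
      [set r | r <= c * (t - s)]); last exact: closed_le.
    move=> g _; apply: (@continuous_comp _ _ _ (fun g : T => g t - g s)).
      exact: (cvgB (cev t g) (cev s g)).
    exact: euclid_norm_continuous.
  apply: (@preimage_closed _ _ (fun g : T => g 1) [set \val y]).
    by move=> g _; exact: cev.
  apply: compact_closed; first exact: norm_hausdorff.
  exact: compact_set1.
have cKL : compact (K `&` L) by exact: compact_closedI.
have clE : closed ((fun g : T => g 0) @` (K `&` L)).
  apply: compact_closed; first exact: norm_hausdorff.
  by apply: continuous_compact cKL; apply: continuous_subspaceT; exact: cev.
rewrite (_ : [set x | _] = set_val @^-1` ((fun g : T => g 0) @` (K `&` L))).
  by apply: preimage_closed clE => x _; exact: initial_continuous.
apply/seteqP; split => x /=.
  move=> [g [g0 g1 gl]]; exists (fun t => \val (g t)); last by rewrite g0.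
  split; first by move=> t; exact: set_valP.
  by split; [move=> [s t] [/= s0 st t1]; exact: gl | rewrite /= g1].
move=> [g [Kg [gl /= g1]] g0].
exists (fun t => exist _ (g t) (mem_set (Kg t))); split.
- by apply: val_inj; rewrite /= g0.
- by apply: val_inj; rewrite /= g1.
- by move=> s t s0 st t1; apply: (gl (s, t)).
Qed.

End lipschitz_curves.

(** * The realization of a graph *)

Section geometric_realization.
Context (R : realType) (W : finType) (adj : W -> W -> Prop).
Local Notation K := (realization R adj).
Implicit Types (p q : K) (x y v : W).

Definition simplex x y := x = y \/ adj x y.

Definition carried p x y := forall v, \val p v != 0 -> v = x \/ v = y.

Lemma realization_carried p : exists x y, simplex x y /\ carried p x y.
Proof. by have [_ _ ] := set_valP p. Qed.

Lemma realization_coord p v : 0 <= \val p v <= 1.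
Proof.
have [p0 <- _] := set_valP p; rewrite p0 /= (bigD1 v) //= lerDl.
by apply: sumr_ge0 => i _; exact: p0.
Qed.

(** Coordinates vanish off [x] and [y] and sum to 1, so the weight of [y] is the parameter along the
    edge. For [x = y] that weight is 1 and the first term drops out. *)
Lemma carried_sum p x y (h : W -> R) : carried p x y ->
  \sum_v \val p v * h v = (1 - \val p y) * h x + \val p y * h y.
Proof.
move=> pxy; have [_ p1 _] := set_valP p.
have zero v : v != x -> v != y -> \val p v = 0.
  move=> vx vy; apply/eqP; apply: contraT => /pxy[] e; [move: vx | move: vy];
  by rewrite e eqxx.
have [xy|xy] := eqVneq x y.
  have sE (k : W -> R) : \sum_v \val p v * k v = \val p y * k y.
    rewrite (bigD1 y) //= big1 ?addr0 // => v vy.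
    by rewrite zero ?mul0r // xy.
  have py : \val p y = 1.
    by rewrite -p1 -[LHS]mulr1 -(sE (fun=> 1)); apply: eq_bigr => v _; rewrite mulr1.
  by rewrite sE py subrr mul0r add0r.
have sE (k : W -> R) : \sum_v \val p v * k v = \val p x * k x + \val p y * k y.
  rewrite (bigD1 x) //= (bigD1 y) ?(eq_sym y) //= big1 ?addr0 // => v /andP[vx vy].
  by rewrite zero ?mul0r.
have : \sum_v \val p v * 1 = 1 by rewrite -[RHS]p1; apply: eq_bigr => v _; rewrite mulr1.
by rewrite !sE !mulr1 => <-; rewrite addrK.
Qed.

Lemma realization_coord_continuous v : continuous (fun p => \val p v).
Proof.
move=> p; apply: (@continuous_comp _ _ _ (set_val : K -> {ptws W -> R})
  (fun g : {ptws W -> R} => g v)).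
  exact: initial_continuous.
exact: (@proj_continuous _ (fun _ : W => R)).
Qed.

Lemma closed_carried x y : closed [set p : K | carried p x y].
Proof.
rewrite (_ : [set p | _] = \bigcap_(v in [set v | v != x /\ v != y])
    [set p : K | \val p v = 0]).
  apply: closed_bigI => v _.
  apply: (@preimage_closed K R (fun p : K => \val p v) [set 0]).
    by move=> p _; exact: realization_coord_continuous.
  exact: closed_eq.
apply/seteqP; split => p /= pxy v.
  move=> [vx vy]; apply/eqP; apply: contraT => /pxy[] e; [move: vx | move: vy];
  by rewrite e eqxx.
move=> pv; have [->|vx] := eqVneq v x; first by left.
have [->|vy] := eqVneq v y; first by right.
by move/eqP: pv => []; exact: pxy.
Qed.

Lemma cone_subproof p x y t : simplex x y -> carried p x y -> 0 <= t <= 1 ->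
  K (fun v => (1 - t) * \val p v + t * (v == x)%:R).
Proof.
move=> xy pxy /andP[t0 t1]; have [p0 p1 _] := set_valP p; split.
- by move=> v; rewrite addr_ge0 // mulr_ge0 // ?subr_ge0 // ler0n.
- rewrite big_split /= -!mulr_sumr p1 (bigD1 x) //= eqxx big1 ?addr0 ?mulr1 ?subrK //.
  by move=> v /negbTE ->.
- exists x, y; split => // v; have [->|vx] := eqVneq v x; first by left.
  by rewrite mulr0 addr0 mulf_eq0 negb_or => /andP[_ /pxy].
Qed.

Definition vertex_fun x : {ptws W -> R} := fun v => (v == x)%:R.

Lemma vertex_subproof x : K (vertex_fun x).
Proof.
split.
- by move=> v; exact: ler0n.
- rewrite (bigD1 x) //= /vertex_fun eqxx big1 ?addr0 // => v /negbTE -> //.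
- exists x, x; split; first by left.
  move=> v; have [->|vx] := eqVneq v x; first by left.
  by rewrite /vertex_fun (negbTE vx) eqxx.
Qed.

Definition vertex x : K := exist _ (vertex_fun x) (mem_set (vertex_subproof x)).

Lemma vertexE x v : \val (vertex x) v = (v == x)%:R.
Proof. by []. Qed.

Lemma vertex_carried x y : carried (vertex x) x y.
Proof.
move=> v; rewrite vertexE; have [->|vx] := eqVneq v x; first by left.
by rewrite eqxx.
Qed.

Lemma vertex_carriedr x y : carried (vertex x) y x.
Proof. by move=> v /vertex_carried -/(_ x)[]; right. Qed.

Lemma affine_extension_vertex (h : W -> R) x : affine_extension h (vertex x) = h x.
Proof.
rewrite /affine_extension (carried_sum _ (@vertex_carriedr x x)) vertexE eqxx.
by rewrite subrr mul0r add0r mul1r.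
Qed.

(** Along the straight segment from [p] to the vertex the extension is affine, so its values stay in
    the convex set [J]. *)
Lemma affine_extension_joined (h : W -> R) (J : open_interval R) p x y :
  simplex x y -> carried p x y ->
  (J : set R) (affine_extension h p) -> (J : set R) (h x) ->
  path_joined R (@affine_extension R W adj h @^-1` J) p (vertex x).
Proof.
move=> xy pxy Jp Jx.
pose q t : {ptws W -> R} := fun v => (1 - t) * \val p v + t * (v == x)%:R.
pose g t : K := insubd p (q t).
have gE t : 0 <= t <= 1 -> \val (g t) = q t.
  by move=> tI; rewrite insubdK //; apply/mem_set/(cone_subproof xy pxy tI).
exists g; split.
- apply: within_continuous_set_type.
  apply: (@subspace_eq_continuous _ _ _ (from_subspace _ q)).
    by move=> t; rewrite inE /= in_itv /= => tI; exact: (esym (gE t tI)).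
  apply: continuous_subspaceT => t; apply/cvg_sup => v.
  apply: (@continuous_comp_initial _ R R (fun f : W -> R => f v)) => {}t /=.
  apply: cvgD; (apply: cvgM; last exact: cvg_cst); last exact: cvg_id.
  by apply: cvgB; [exact: cvg_cst | exact: cvg_id].
- apply: val_inj; rewrite gE ?lexx ?ler01 //; apply/funext => v.
  by rewrite /q subr0 mul1r mul0r addr0.
- apply: val_inj; rewrite gE ?lexx ?ler01 //; apply/funext => v.
  by rewrite /q subrr mul1r mul0r add0r.
- move=> t; rewrite in_itv /= => tI.
  suff -> : affine_extension h (g t) = (1 - t) * affine_extension h p + t * h x.
    exact: interval_convex.
  rewrite /affine_extension gE // -{1}(affine_extension_vertex h x).
  rewrite /affine_extension !mulr_sumr -big_split /=.
  by apply: eq_bigr => v _; rewrite /q /= /vertex_fun; ring.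
Qed.

(** * Maps out of the realization given by one path per edge *)

Section edge_paths.
Context (Z : topologicalType) (pt : W -> Z) (gamma : W -> W -> R -> Z).
Hypothesis simplex_sym : forall x y, simplex x y -> simplex y x.
Hypothesis gamma0 : forall x y, gamma x y 0 = pt x.
Hypothesis gamma1 : forall x y, gamma x y 1 = pt y.
Hypothesis gamma_continuous : forall x y, {within `[0, 1], continuous (gamma x y)}.

(* Ordering the vertices selects one of the two orientations of each edge. *)
Definition edge_of p (e : W * W) :=
  [/\ (enum_rank e.1 <= enum_rank e.2)%N, simplex e.1 e.2 & carried p e.1 e.2].

Lemma edge_of_ex p : exists e, edge_of p e.
Proof.
have [x [y [xy pxy]]] := realization_carried p.
case: (leqP (enum_rank x) (enum_rank y)) => [le_xy|/ltnW le_yx].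
  by exists (x, y).
exists (y, x); split => //; first exact: simplex_sym.
by move=> v /pxy[] ->; [right | left].
Qed.

Definition edge_map p : Z :=
  let e := projT1 (cid (edge_of_ex p)) in gamma e.1 e.2 (\val p e.2).

Lemma edge_of_vertex p v e : edge_of p e -> \val p v = 1 ->
  gamma e.1 e.2 (\val p e.2) = pt v.
Proof.
case: e => x y [_ _ pxy] pv; have {}pxy : carried p x y := pxy.
rewrite -[LHS]/(gamma x y (\val p y)).
have sx := carried_sum (fun v => (v == x)%:R) pxy.
have [e|vy] := eqVneq v y; first by rewrite -e pv gamma1 e.
have [e|] : v = x \/ v = y by apply: pxy; rewrite pv oner_eq0.
  suff -> : \val p y = 0 by rewrite gamma0 e.
  have {sx} : 1 = 1 - \val p y.
    rewrite -e in vy sx; move: sx; rewrite (eq_sym y) (negbTE vy) eqxx mulr0 addr0 mulr1 => <-.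
    rewrite (bigD1 v) //= eqxx pv mulr1 big1 ?addr0 // => w /negbTE ->.
    by rewrite mulr0.
  by move=> h; apply/eqP; rewrite -oppr_eq0; apply/eqP; lra.
by move=> e; rewrite e eqxx in vy.
Qed.

(** Away from the vertices both endpoint coordinates are nonzero, so the two edges have the same
    endpoints; the vertex order excludes a swap. *)
Lemma edge_of_unique p e e' : (forall v, \val p v <> 1) ->
  edge_of p e -> edge_of p e' -> e = e'.
Proof.
case: e e' => x y [x' y'] p1 [rxy _ pxy] [rxy' _ pxy'].
have {}pxy : carried p x y := pxy; have {}pxy' : carried p x' y' := pxy'.
have sx := carried_sum (fun v => (v == x)%:R) pxy.
have px : \sum_v \val p v * (v == x)%:R = \val p x.
  by rewrite (bigD1 x) //= eqxx mulr1 big1 ?addr0 // => w /negbTE ->; rewrite mulr0.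
rewrite px eqxx mulr1 in sx.
have [e|xy] := eqVneq y x.
  by case: (p1 x); rewrite sx e eqxx mulr1 subrK.
rewrite (negbTE xy) mulr0 addr0 in sx.
have py0 : \val p y != 0.
  by apply/eqP => py; apply: (p1 x); rewrite sx py subr0.
have px0 : \val p x != 0.
  apply/eqP => px0; apply: (p1 y); move: sx; rewrite px0 => /eqP.
  by rewrite eq_sym subr_eq0 => /eqP.
case: (pxy' _ px0) => ex; case: (pxy' _ py0) => ey.
- by rewrite ey ex eqxx in xy.
- by rewrite ex ey.
- have /eqP : x = y.
    by apply/enum_rank_inj/val_inj/eqP; rewrite eqn_leq rxy /= ex ey; exact: rxy'.
  by rewrite eq_sym (negbTE xy).
- by rewrite ey ex eqxx in xy.
Qed.

(** The value does not depend on the chosen edge: at a vertex every edge path gives [pt v], and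
    elsewhere the oriented edge is unique. *)
Lemma edge_mapE p e : edge_of p e -> edge_map p = gamma e.1 e.2 (\val p e.2).
Proof.
move=> pe; rewrite /edge_map; case: (cid _) => e' /= pe'.
case: (pselect (exists v, \val p v = 1)) => [[v pv]|nv].
  by rewrite (edge_of_vertex pe pv) (edge_of_vertex pe' pv).
by rewrite (edge_of_unique _ pe' pe) // => v pv; apply: nv; exists v.
Qed.

Lemma edge_map_vertex x : edge_map (vertex x) = pt x.
Proof.
have [e xe] := edge_of_ex (vertex x).
by rewrite (edge_mapE xe) (edge_of_vertex xe (v := x)) // vertexE eqxx.
Qed.

Lemma edge_path_continuous x y : continuous (fun p => gamma x y (\val p y)).
Proof.
move=> p U nU.
have /subspace_continuousP /(_ (\val p y)) := @gamma_continuous x y.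
rewrite /= in_itv /= => /(_ (realization_coord p y) U nU).
move/(@realization_coord_continuous y p).
by apply: (@filterS _ (nbhs p)) => q /=; rewrite in_itv /=; apply; exact: realization_coord.
Qed.

(** Pasting over the finite cover by closed edges: the preimage of a closed set is a finite union of
    closed sets. *)
Lemma edge_map_continuous : continuous edge_map.
Proof.
apply/continuous_closedP => D clD.
rewrite (_ : edge_map @^-1` D = \bigcup_(e in [set: W * W])
    [set p : K | edge_of p e /\ D (gamma e.1 e.2 (\val p e.2))]).
  apply: closed_bigcup; first exact: finite_finset.
  move=> -[x y] _ /=.
  (* Pairs that are not correctly ordered simplices contribute the empty set. *)
  case: (pselect ((enum_rank x <= enum_rank y)%N /\ simplex x y)) => [[rxy xy]|nxy].
    rewrite (_ : [set p | _] = [set p : K | carried p x y] `&`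
        (fun p => gamma x y (\val p y)) @^-1` D).
      apply: closedI; first exact: closed_carried.
      by apply: preimage_closed clD => p _; exact: edge_path_continuous.
    by apply/seteqP; split => p /= [] // [].
  rewrite (_ : [set p | _] = set0); first exact: closed0.
  by apply/seteqP; split => p //= -[[rxy xy _] _]; exact: nxy.
apply/seteqP; split => p /=.
  have [e pe] := edge_of_ex p; rewrite (edge_mapE pe) => De.
  by exists e.
by move=> [e _ /= [pe]]; rewrite (edge_mapE pe).
Qed.

End edge_paths.

End geometric_realization.

(** * The estimator *)

Section modulus.
Context (R : realType) (m : nat) (X : set 'rV[R]_m).
Context (f : X -> R) (omega : R -> R) (gamma : X -> X -> R -> X).
Hypothesis f_omega : modulus_of_continuity f omega.
Hypothesis gammaP : forall x y : X, minimizing_geodesic x y (gamma x y).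

Lemma lipschitz_joinedP (c : R) (x y : X) :
  lipschitz_joined c x y <-> (intrinsic_dist x y <= c%:E)%E.
Proof.
split=> [|dc]; first exact: lipschitz_joined_dist.
have [[_ g0 g1 _] _ _] := gammaP x y.
by exists (gamma x y); split => //; exact: geodesic_lipschitz dc.
Qed.

Lemma modulus_lipschitz_joined (c : R) (x y : X) : 0 <= c ->
  lipschitz_joined c x y -> `|f x - f y| <= omega c.
Proof.
move=> c0 /lipschitz_joined_dist dc; have [_ mono _ fo] := f_omega.
apply: le_trans (fo x y) _; apply: mono.
  exact/fine_ge0/intrinsic_dist_ge0.
(* The bound by [c] excludes an infinite distance, which [fine] would send to 0. *)
rewrite -lee_fin fineK // ge0_fin_numE ?intrinsic_dist_ge0 //.
exact: le_lt_trans dc (ltry _).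
Qed.

(** Every point of the curve is within [c] of [x], so [f] moves by at most [omega c] along it. *)
Lemma path_joined_lipschitz (c : R) (e : {nonneg R}) (I : open_interval R)
    (x y : X) : 0 <= c -> omega c <= e%:num -> (I : set R) (f x) ->
  lipschitz_joined c x y -> path_joined R (f @^-1` thicken e I) x y.
Proof.
move=> c0 ce Ix [g [g0 g1 lip]]; exists g; split => //.
  exact: lipschitz_curve_continuous lip.
move=> t; rewrite in_itv /= => tI; apply: thicken_near Ix _.
apply: le_trans ce; apply: modulus_lipschitz_joined => //.
rewrite -g0; apply: lipschitz_joined_le (lipschitz_joined_initial lip tI).
by have /andP[t0 t1] := tI; rewrite ler_piMr.
Qed.

Lemma theta_bound (delta e : R) (x y : X) (t : R) :
  (theta f gamma delta <= e%:E)%E ->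
  (intrinsic_dist x y <= (2 * delta)%:E)%E -> 0 <= t <= 1 ->
  `|f (gamma x y t) - ((1 - t) * f x + t * f y)| <= e.
Proof.
move=> the dxy tI; rewrite -lee_fin; apply: le_trans the.
apply: le_trans (_ : maxe _ _ <= _)%E; last first.
  by apply: ereal_sup_ubound; exists (x, y).
rewrite le_max; apply/orP; right; apply: ereal_sup_ubound.
by exists t => //=; rewrite in_itv.
Qed.

(* Along a geodesic of length [l <= 2 delta], concavity bounds the deviation at
   time [t] by [omega (2 t (1 - t) l)], and [2 t (1 - t) <= 1 / 2]. *)
Lemma theta_le_concave (delta : R) : 0 <= delta -> concave_nonneg omega ->
  (theta f gamma delta <= (omega delta)%:E)%E.
Proof.
move=> d0 conc; have [pos mono o0 _] := f_omega.
apply: ge_ereal_sup => _ [[x y] /= dxy <-].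
have l0 := intrinsic_dist_ge0 x y.
have [l lE] : exists l, intrinsic_dist x y = l%:E.
  exists (fine (intrinsic_dist x y)); rewrite fineK // ge0_fin_numE //.
  exact: le_lt_trans dxy (ltry _).
move: dxy l0; rewrite lE !lee_fin => ld l0.
have lip : lipschitz_curve l (gamma x y).
  by apply: geodesic_lipschitz (gammaP x y) _; rewrite lE.
have [[_ g0 g1 _] _ _] := gammaP x y.
rewrite ge_max lee_fin; apply/andP; split.
  have fl : `|f x - f y| <= omega l.
    by apply: modulus_lipschitz_joined => //; apply/lipschitz_joinedP; rewrite lE.
  have := mono l (2 * delta) l0 ld.
  (* Concavity at the midpoint of 0 and [2 * delta] gives half of [omega (2 * delta)] as a lower
     bound for [omega delta]. *)
  have := conc 0 (2 * delta) 2^-1 (lexx 0).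
  rewrite o0 !mulr0 !add0r mulrA mulVf // mul1r => h ol.
  by have := h _ _; lra.
apply: ge_ereal_sup => _ [t tI <-]; rewrite /= in_itv /= in tI; rewrite lee_fin.
have /andP[t0 t1] := tI.
have fx : `|f x - f (gamma x y t)| <= omega (l * t).
  apply: modulus_lipschitz_joined; first exact: mulr_ge0.
  by rewrite -{1}g0; exact: lipschitz_joined_initial.
have fy : `|f y - f (gamma x y t)| <= omega (l * (1 - t)).
  apply: modulus_lipschitz_joined; first by rewrite mulr_ge0 // subr_ge0.
  by rewrite -{1}g1; exact: lipschitz_joined_final.
have c : (1 - t) * omega (l * t) + t * omega (l * (1 - t)) <= omega delta.
  apply: le_trans (conc (l * t) (l * (1 - t)) t _ _ tI) _.
  - exact: mulr_ge0.
  - by rewrite mulr_ge0 // subr_ge0.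
  - rewrite (_ : _ + _ = l * (2 * t * (1 - t))); last by ring.
    have t01 : 0 <= 2 * t * (1 - t) by rewrite !mulr_ge0 // subr_ge0.
    have half : 2 * t * (1 - t) <= 2^-1 by have := sqr_ge0 (2 * t - 1); lra.
    apply: mono; first exact: mulr_ge0.
    by apply: le_trans (ler_wpM2l l0 half) _; lra.
apply: le_trans c.
(* As the weights sum to 1, the deviation is a convex combination of the differences to the two
   endpoint values. *)
have -> : f (gamma x y t) - ((1 - t) * f x + t * f y) =
  - ((1 - t) * (f x - f (gamma x y t)) + t * (f y - f (gamma x y t))) by ring.
rewrite normrN; apply: le_trans (ler_normD _ _) _.
rewrite !normrM (ger0_norm t0) (@ger0_norm _ (1 - t)) ?subr_ge0 //.
by apply: lerD; rewrite ler_wpM2l // subr_ge0.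
Qed.

(** * The two maps between the space and the sample complex *)

Context (S : {fset X}) (delta : R) (e : {nonneg R}).
Hypothesis X_compact : compact X.
Hypothesis f_continuous : continuous f.
Hypothesis f_constructible : constructible f.
Hypothesis delta_gt0 : 0 < delta.
Hypothesis S_covers : covering_radius S delta.
Hypothesis omega_le : omega delta <= e%:num.
Hypothesis theta_le : (theta f gamma delta <= e%:num%:E)%E.

Local Notation adj := (@sample_adj R m X S delta).
Local Notation plf := (@pl_fun R m X S f delta).
Local Notation vtx := (@vertex R S adj).
Local Notation joined := (@path_joined R (sample_complex S delta)).

Lemma near_sample (x : X) (s : X) :
  lipschitz_joined delta x s -> `|f x - f s| <= e%:num.
Proof.
by move=> xs; apply: le_trans omega_le; apply: modulus_lipschitz_joined => //; exact: ltW.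
Qed.

Lemma simplexP (s s' : S) :
  simplex adj s s' <-> lipschitz_joined (2 * delta) (\val s) (\val s').
Proof.
split=> [[->|[_ /lipschitz_joinedP //]] | ss'].
  by apply: lipschitz_joined_refl; rewrite mulr_ge0 // ltW.
have [->|ne] := eqVneq s s'; [by left | right; split => //].
exact/lipschitz_joinedP.
Qed.

Lemma simplex_sample_sym (s s' : S) : simplex adj s s' -> simplex adj s' s.
Proof. by move=> /simplexP/lipschitz_joined_sym/simplexP. Qed.

Lemma nearest_ex (x : X) : exists s : S, lipschitz_joined delta x (\val s).
Proof.
have [s sS /lipschitz_joinedP xs] := S_covers x.
by exists [` sS]%fset.
Qed.

(** A chosen sample within [delta] of [x], not necessarily a closest one. *)
Definition nearest (x : X) : S := projT1 (cid (nearest_ex x)).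

Lemma nearestP (x : X) : lipschitz_joined delta x (\val (nearest x)).
Proof. by rewrite /nearest; case: cid. Qed.

Lemma pl_fun_vertex (s : S) : plf (vtx s) = f (\val s).
Proof. exact: affine_extension_vertex. Qed.

(** Through [x] the samples are within [2 * delta], so they span a simplex; both end values lie in
    the thickened interval, hence so do the values between. *)
Lemma samples_joined (I : open_interval R) (x : X) (s s' : S) :
  (I : set R) (f x) -> lipschitz_joined delta x (\val s) ->
  lipschitz_joined delta x (\val s') ->
  joined (plf @^-1` thicken e I) (vtx s) (vtx s').
Proof.
move=> Ix xs xs'.
have ss' : simplex adj s s'.
  by apply/simplexP; apply: lipschitz_joined_trans xs'; exact: lipschitz_joined_sym.
have Is := thicken_near Ix (near_sample xs).
have Is' := thicken_near Ix (near_sample xs').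
apply: path_joined_sym.
apply: (affine_extension_joined ss') => //; first exact: vertex_carriedr.
by rewrite affine_extension_vertex.
Qed.

(* A path in [X] need not be rectifiable; it is nevertheless covered by finitely
   many closed balls, and balls that meet along it have adjacent centres. *)
Lemma nearest_joined (I : open_interval R) (x x' : X) :
  path_joined R (f @^-1` I) x x' ->
  joined (plf @^-1` thicken e I) (vtx (nearest x)) (vtx (nearest x')).
Proof.
move=> xx'; have [Ix Ix'] := path_joined_mem xx'.
pose J := plf @^-1` thicken e I.
pose B (s : S) := [set a : X | lipschitz_joined delta a (\val s)].
pose C := \bigcup_(s in [set s | joined J (vtx (nearest x)) (vtx s)]) B s.
pose D := \bigcup_(s in [set s | ~ joined J (vtx (nearest x)) (vtx s)]) B s.
have clB s : closed (B s) by exact: closed_lipschitz_ball.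
have Cx : C x.
  exists (nearest x); last exact: nearestP.
  exact: samples_joined Ix (nearestP x) (nearestP x).
have [s xs Bs] : C x'.
  apply: (path_joined_closed (C := C) (D := D) _ _ _ _ xx' Cx).
  - by apply: closed_bigcup => //; exact: finite_finset.
  - by apply: closed_bigcup => //; exact: finite_finset.
  - move=> a _; have Ba : B (nearest a) a by exact: nearestP.
    case: (pselect (joined J (vtx (nearest x)) (vtx (nearest a)))) => h;
    by [left; exists (nearest a) | right; exists (nearest a)].
  - move=> a Ia [s xs Bs] [s' nxs' Bs']; apply: nxs'.
    exact: path_joined_trans xs (samples_joined Ia Bs Bs').
exact: path_joined_trans xs (samples_joined Ix' Bs (nearestP x')).
Qed.

Definition sample_geodesic (s s' : S) : R -> X := gamma (\val s) (\val s').

Definition sample_map : sample_complex S delta -> X :=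
  edge_map sample_geodesic simplex_sample_sym.

Lemma sample_geodesic0 (s s' : S) : sample_geodesic s s' 0 = \val s.
Proof. by have [[]] := gammaP (\val s) (\val s'). Qed.

Lemma sample_geodesic1 (s s' : S) : sample_geodesic s s' 1 = \val s'.
Proof. by have [[]] := gammaP (\val s) (\val s'). Qed.

Lemma sample_geodesic_continuous (s s' : S) :
  {within `[0, 1], continuous (sample_geodesic s s')}.
Proof. by have [[]] := gammaP (\val s) (\val s'). Qed.

Lemma sample_map_continuous : continuous sample_map.
Proof.
exact: edge_map_continuous sample_geodesic0 sample_geodesic1
  sample_geodesic_continuous.
Qed.

Lemma sample_map_vertex (s : S) : sample_map (vtx s) = \val s.
Proof.
exact: (edge_map_vertex simplex_sample_sym sample_geodesic0 sample_geodesic1).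
Qed.

Lemma sample_mapE (p : sample_complex S delta) : exists s s', [/\
  simplex adj s s', carried p s s' & sample_map p = sample_geodesic s s' (\val p s')].
Proof.
have [[s s'] ps] := edge_of_ex simplex_sample_sym p.
exists s, s'; have [_ ss' pss'] := ps; split => //.
exact: (edge_mapE simplex_sample_sym sample_geodesic0 sample_geodesic1 ps).
Qed.

(** [plf p] interpolates the endpoint values at the very parameter where the geodesic is evaluated,
    so the gap is the deviation measured by [theta]. *)
Lemma near_sample_map (p : sample_complex S delta) :
  `|plf p - f (sample_map p)| <= e%:num.
Proof.
have [s [s' [ss' pss' ->]]] := sample_mapE p.
rewrite /pl_fun /affine_extension (carried_sum _ pss') distrC.
apply: theta_bound theta_le _ (realization_coord p s').
by apply/lipschitz_joinedP/simplexP.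
Qed.

(** Some endpoint [s] of the edge of [p] is within [delta] of the image of [p]; it is joined to the
    chosen sample through that image and to [p] along the edge. *)
Lemma nearest_sample_map (I : open_interval R) (p : sample_complex S delta) :
  (I : set R) (plf p) ->
  joined (plf @^-1` thicken e (thicken e I)) (vtx (nearest (sample_map p))) p.
Proof.
move=> Ip; have Gp := thicken_near Ip (near_sample_map p).
suff [s [s' [ss' pss' Gs]]] : exists s s', [/\ simplex adj s s',
    carried p s s' & lipschitz_joined delta (sample_map p) (\val s)].
  apply: path_joined_trans (samples_joined Gp (nearestP _) Gs) _.
  apply: path_joined_sym; apply: (affine_extension_joined ss' pss').
    exact: sub_thicken2.
  exact: thicken_near Gp (near_sample Gs).
have [s [s' [ss' pss' GE]]] := sample_mapE p.
have lip : lipschitz_curve (2 * delta) (sample_geodesic s s').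
  by apply: geodesic_lipschitz (gammaP _ _) _; apply/lipschitz_joinedP/simplexP.
have pI := realization_coord p s'; have d0 := delta_gt0.
(* The geodesic is [2 * delta]-Lipschitz, so the half containing the parameter tells which endpoint
   is within [delta]. *)
case: (leP (\val p s') 2^-1) => ps'; [exists s, s' | exists s', s]; split => //.
- rewrite GE -(sample_geodesic0 s s'); apply: lipschitz_joined_sym.
  by apply: lipschitz_joined_le (lipschitz_joined_initial lip pI); nra.
- exact: simplex_sample_sym.
- by move=> v /pss'[] ->; [right | left].
- rewrite GE -(sample_geodesic1 s s'); apply: lipschitz_joined_sym.
  by apply: lipschitz_joined_le (lipschitz_joined_final lip pI); nra.
Qed.

Lemma estimator_interleaved :
  interleaved e (pi0_functor (@reeb_fun R X f)) (pl_reeb_estimator S f delta).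
Proof.
have lX := constructible_locally_path_joined f_constructible.
have cpi : continuous (@reeb_pi R X f) by exact: pi_continuous.
apply: (@interleaved_of_maps R (reeb_space f) (sample_complex S delta)
  (@reeb_fun R X f) plf e (fun z => vtx (nearest (repr z)))
  (fun p => reeb_pi f (sample_map p))).
- by move=> z; rewrite pl_fun_vertex; exact/near_sample/nearestP.
- by move=> p; rewrite reeb_funE; exact: near_sample_map.
- move=> I z z' zz'; apply: nearest_joined.
  exact: reeb_path_lift lX f_continuous (@open_interval_open _ I) zz'.
- move=> I p p'; apply: (path_joined_image (g := reeb_pi f \o sample_map)).
    by move=> p0; apply: continuous_comp; [exact: sample_map_continuous | exact: cpi].
  by move=> p0 Ip0; rewrite /= reeb_funE; exact: thicken_near Ip0 (near_sample_map _).
- move=> I z Iz.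
  rewrite /= sample_map_vertex.
  rewrite -{2}(reprK z); apply: (path_joined_image (A := f @^-1` thicken e I)) => //.
    by move=> a Ia; rewrite /= reeb_funE; exact: sub_thicken.
  apply: path_joined_sym.
  exact: path_joined_lipschitz (ltW delta_gt0) omega_le Iz (nearestP _).
(* The round trip replaces the image of [p] by the representative of its Reeb class. A path within
   one level joins the two, and [nearest_joined] over [thicken e I] carries it to the samples. *)
- move=> I p Ip; apply: path_joined_trans (nearest_sample_map Ip).
  apply: nearest_joined; have Gp := thicken_near Ip (near_sample_map p).
  apply: path_joined_sym; pose a := repr (reeb_pi f (sample_map p)).
  have : reeb_rel f (sample_map p) a.
    rewrite reeb_rel_sym.
    have /eqmodP // : a = sample_map p %[mod {eq_quot reeb_equiv f}].
    exact: reprK.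
  by move/asboolP; apply: path_joined_subset => w /= ->.
Qed.

End modulus.

Theorem theorem4p1 (R : realType) (m : nat) (X : set 'rV[R]_m) (S : {fset X})
    (f : X -> R) (omega : R -> R) (gamma : X -> X -> R -> X) (delta : R) :
  compact X ->
  (forall x y : X, (intrinsic_dist x y < +oo)%E) ->
  continuous f ->
  constructible f ->
  modulus_of_continuity f omega ->
  (forall x y : X, minimizing_geodesic x y (gamma x y)) ->
  0 < delta ->
  covering_radius S delta ->
  let F_R := pi0_functor (@reeb_fun R X f) in
  let R_delta := pl_reeb_estimator S f delta in
  [/\ (interleaving_dist F_R R_delta <= mu f omega gamma delta)%E,
      concave_nonneg omega -> omega 0 = 0 ->
        (interleaving_dist F_R R_delta <= (omega delta)%:E)%E &
      lipschitz1 f -> (interleaving_dist F_R R_delta <= delta%:E)%E].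
Proof.
move=> cX fin cf consf fo gammaP d0 cov F_R R_delta.
(* The modulus is kept general so that the Lipschitz case can use the identity. *)
have main (o : R -> R) : modulus_of_continuity f o ->
    (interleaving_dist F_R R_delta <= mu f o gamma delta)%E.
  move=> fo'; have [pos _ _ _] := fo'.
  have omu : ((o delta)%:E <= mu f o gamma delta)%E by rewrite le_max lexx.
  have tmu : (theta f gamma delta <= mu f o gamma delta)%E.
    by rewrite le_max lexx orbT.
  (* A real value of [mu] is itself an admissible shift, [+oo] is trivial, and [-oo] contradicts the
     lower bound [o delta]. *)
  move: omu tmu; case: (mu f o gamma delta) => [r||] //.
  - rewrite lee_fin => omu tmu.
    have r0 : 0 <= r by apply: le_trans omu; apply: pos; exact: ltW.
    apply: ereal_inf_lbound; exists (NngNum r0) => //=.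
    exact: (@estimator_interleaved _ _ _ f o gamma fo' gammaP S delta (NngNum r0)).
  - by move=> _ _; exact: leey.
have conc (o : R -> R) : modulus_of_continuity f o -> concave_nonneg o ->
    (interleaving_dist F_R R_delta <= (o delta)%:E)%E.
  move=> fo' co; apply: le_trans (main o fo') _.
  by rewrite ge_max lexx /=; apply: theta_le_concave => //; exact: ltW.
split; first exact: main.
  by move=> co _; exact: conc.
(* For 1-Lipschitz [f] the identity is a concave modulus; finiteness of the distance lets [fine] be
   undone. *)
move=> lf; apply: (conc id) => [|u v t _ _ _ //]; split => // x y.
have dE : (fine (intrinsic_dist x y))%:E = intrinsic_dist x y.
  by rewrite fineK // ge0_fin_numE ?intrinsic_dist_ge0.
by rewrite -lee_fin dE; exact: lf.
Qed.
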